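(* If $G$ is an outerplanar graph, then $\mathrm{HG}(G) < 2^{125000}$.
   Context: All graphs are finite and simple. The hat guessing game on a graph $G$ with color set $S$: a (deterministic) strategy is a family $\Gamma=\{\Gamma_v\}_{v\in V(G)}$ of functions $\Gamma_v: S^{N(v)}\to S$, where $N(v)$ is the set of neighbors of $v$. The strategy is winning if for every (not necessarily proper) coloring $\phi:V(G)\to S$ there is a vertex $v$ with $\Gamma_v(\phi|_{N(v)})=\phi(v)$. The hat guessing number $\mathrm{HG}(G)$ is the maximum $k$ such that a winning strategy exists with color set $S=\{1,\dots,k\}$. *)

(* Defs.v *)
From HB Require Import structures.
From mathcomp Require Import all_boot all_order all_algebra.
From mathcomp Require Import all_classical all_reals all_analysis.

Set Implicit Arguments.
Unset Strict Implicit.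
Unset Printing Implicit Defensive.

Import Order.TTheory GRing.Theory Num.Theory.
Import numFieldNormedType.Exports.

Local Open Scope ring_scope.

Record sgraph := SGraph {
  vertex :> finType;
  adj : rel vertex;
  adj_sym : symmetric adj;
  adj_irrefl : irreflexive adj }.

(** * Hat guessing *)

Definition nbhd (G : sgraph) (v : G) : finType := {u : G | adj v u}.

Definition strategy (G : sgraph) (S : finType) : Type :=
  forall v : G, {ffun nbhd v -> S} -> S.

Definition restrict_nbhd (G : sgraph) (S : finType) (phi : {ffun G -> S})
    (v : G) : {ffun nbhd v -> S} :=
  [ffun u => phi (val u)].

Definition winning (G : sgraph) (S : finType) (Gamma : strategy G S) : Prop :=
  forall phi : {ffun G -> S}, exists v : G, Gamma v (restrict_nbhd phi v) = phi v.

Definition winnable (G : sgraph) (k : nat) : Prop :=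
  exists Gamma : strategy G 'I_k, winning Gamma.

(* The default value 0 is reached only by the graph with no vertices, for which
   no number of colors is winnable; see [hat_guessing_number_max]. *)
Definition hat_guessing_number (G : sgraph) : nat :=
  xget 0%N [set h | winnable G h /\ forall k, winnable G k -> (k <= h)%N]%classic.

Lemma winnable_le_card (G : sgraph) (k : nat) : winnable G k -> (k <= #|G|)%N.
Proof.
case: k => [//|k] [Gamma win].
pose T : finType := {ffun G -> 'I_k.+1}.
pose A (v : G) : {set T} := [set phi : T | Gamma v (restrict_nbhd phi v) == phi v].
pose upd (v : G) (phi : T) (c : 'I_k.+1) : T :=
  [ffun u => if u == v then c else phi u].
have restr_upd v phi c : restrict_nbhd (upd v phi c) v = restrict_nbhd phi v.
  apply/ffunP => u; rewrite !ffunE; case: eqP => // uv.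
  by have := valP u; rewrite uv adj_irrefl.
have card_A v : (#|A v| * k.+1 <= #|T|)%N.
  have -> : (#|A v| * k.+1)%N = #|finset.setX (A v) [set: 'I_k.+1]|.
    by rewrite finset.cardsX cardsT card_ord.
  pose f (p : T * 'I_k.+1) : T := upd v p.1 p.2.
  rewrite -(@card_in_imset _ _ f); first exact: max_card.
  move=> [p c] [q d]; rewrite !inE !andbT /f /= => /eqP Ap /eqP Aq eq_upd.
  have pq_v : p v = q v by rewrite -Ap -Aq -(restr_upd v p c) eq_upd restr_upd.
  congr pair; last by move/ffunP/(_ v): eq_upd; rewrite !ffunE eqxx.
  apply/ffunP => u; have [->//|uv] := eqVneq u v.
  by move/ffunP/(_ u): eq_upd; rewrite !ffunE (negbTE uv).
have T_gt0 : (0 < #|T|)%N by apply/card_gt0P; exists [ffun=> ord0].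
have card_T : (#|T| <= \sum_(v : G) #|A v|)%N.
  rewrite -cardsT; have -> : [set: T]%SET = (\bigcup_v A v)%SET.
    apply/setP => phi; rewrite inE; apply/esym/bigcupP.
    by have [v Hv] := win phi; exists v => //; rewrite inE Hv.
  apply: (big_ind2 (fun (B : {set T}) n => (#|B| <= n)%N)) => //.
    by rewrite cards0.
  move=> B n C m Bn Cm; apply: leq_trans (leq_add Bn Cm).
  by rewrite cardsU leq_subr.
rewrite -(leq_pmul2l T_gt0).
apply: (leq_trans (leq_mul card_T (leqnn _))).
rewrite big_distrl /= mulnC -sum_nat_const.
by apply: leq_sum => v _; exact: card_A.
Qed.

Lemma winnable1 (G : sgraph) : (0 < #|G|)%N -> winnable G 1.
Proof.
move=> /card_gt0P[v _]; exists (fun _ _ => ord0) => phi; exists v.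
by rewrite (ord1 (phi v)).
Qed.

Lemma hat_guessing_number_max (G : sgraph) : (0 < #|G|)%N ->
  winnable G (hat_guessing_number G) /\
  forall k, winnable G k -> (k <= hat_guessing_number G)%N.
Proof.
move=> G_gt0; rewrite /hat_guessing_number.
set M := [set h | _]%classic.
suff [h Mh] : exists h, M h by exact: (@xgetPex _ 0%N M (ex_intro _ h Mh)).
have exP : exists k, `[< winnable G k >].
  by exists 1%N; apply/asboolP/winnable1.
have leP k : `[< winnable G k >] -> (k <= #|G|)%N.
  by move=> /asboolP/winnable_le_card.
case: (ex_maxnP exP leP) => h /asboolP wh hmax; exists h; split => // k wk.
by apply: hmax; apply/asboolP.
Qed.

(** * Plane drawings *)

Local Open Scope classical_set_scope.

Section Drawing.
Variable R : realType.

Definition is_arc (A : set (R * R)) (p q : R * R) : Prop :=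
  exists g : R -> R * R,
    [/\ {within `[0, 1], continuous g}, {in `[0, 1] &, injective g},
        g 0 = p, g 1 = q & A = g @` `[0, 1]].

(* [arc u v] is only meaningful when [u] and [v] are adjacent; an edge is
   indexed by its two orientations, which must be drawn as the same arc. *)
Record plane_drawing (G : sgraph) := PlaneDrawing {
  pos : G -> R * R;
  arc : G -> G -> set (R * R);
  pos_inj : injective pos;
  arcP : forall u v, adj u v -> is_arc (arc u v) (pos u) (pos v);
  arc_sym : forall u v, adj u v -> arc u v = arc v u;
  arc_vertex : forall u v w, adj u v -> arc u v (pos w) -> w = u \/ w = v;
  arc_cross : forall u v x y, adj u v -> adj x y ->
    [set u; v]%SET <> [set x; y]%SET -> arc u v `&` arc x y `<=` range pos }.

Definition drawn_set (G : sgraph) (D : plane_drawing G) : set (R * R) :=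
  range (pos D) `|` [set p | exists u v, adj u v /\ arc D u v p].

Definition is_face (G : sgraph) (D : plane_drawing G) (F : set (R * R)) : Prop :=
  exists2 p, (~` drawn_set D) p & F = connected_component (~` drawn_set D) p.

(* The drawn set is compact, so there is exactly one unbounded face. *)
Definition is_outer_face (G : sgraph) (D : plane_drawing G)
    (F : set (R * R)) : Prop :=
  is_face D F /\ ~ bounded_set F.

Definition frontier (F : set (R * R)) : set (R * R) := closure F `\` interior F.

Definition outerplanar (G : sgraph) : Prop :=
  exists (D : plane_drawing G) (F : set (R * R)),
    is_outer_face D F /\ forall v : G, frontier F (pos D v).

End Drawing.

(* Main.v *)
Require Import Defs.
From Stdlib Require Import Btauto.
From mathcomp Require Import all_boot boolp.

(** Fix a point [p] of the face [F] and, for every vertex, a fine polygonal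
chain (a "spoke") from [p] that avoids all arcs not ending at that vertex.  For
two disjoint chains the parities of crossings of horizontal rays satisfy a
linear relation over the field with two elements (the van Kampen argument for
the non-planarity of K_5 and K_{3,3}); added up, these relations say that the
tournament [spoke_order] on the vertices "does not separate" disjoint edges.
Such a tournament lets one cut the graph recursively into strips: sets [W]
attached to the rest only by two vertices [u] and [v], with an apex [w] that
splits [W] into a strip for [u], [w] and a strip for [w], [v].

On strips, a colouring in which nobody guesses right is built by induction.
What the induction has to keep is that the neighbours of [u] can be coloured
in the same way for two given colours of [u]: the guess of [u] is then the same
in both cases, so one of the two colours escapes it.  Vertices along a fan are
restricted to 7 colours, so that 49 situations have to be beaten by an apex;
among any 50 colours one of them beats all situations, so at most 49 colours of
the apex are bad for each of the at most 7 * 50 colourings of [u] and [v], and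
any number of colours above 350 * 49 is too many to win. *)

Set Implicit Arguments.
Unset Strict Implicit.
Unset Printing Implicit Defensive.

(** * Strips: ordered pieces cut out by two vertices *)

Section Strip.
Variables (T : finType) (e : rel T).
Hypothesis e_sym : symmetric e.
Hypothesis e_irr : irreflexive e.

Definition enclosed (u v : T) (W : {set T}) : Prop :=
  forall x y, x \in W -> e x y -> [|| y \in W, y == u | y == v].

(** A strip records separations, not edges: the apex [w] need not be adjacent to [u] or [v], and the
    enclosure conditions leave no edge between [W1] and [W2]. *)
Inductive strip : T -> T -> {set T} -> Prop :=
| strip0 u v : u != v -> strip u v set0
| stripU u v w (W1 W2 : {set T}) :
    u != v -> u \notin w |: (W1 :|: W2) -> v \notin w |: (W1 :|: W2) ->
    w \notin W1 :|: W2 -> [disjoint W1 & W2] ->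
    enclosed u v (w |: (W1 :|: W2)) -> enclosed u w W1 -> enclosed w v W2 ->
    strip u w W1 -> strip w v W2 -> strip u v (w |: (W1 :|: W2)).

Lemma enclosed_sym u v W : enclosed u v W -> enclosed v u W.
Proof. by move=> H x y xW exy; have := H x y xW exy; case/or3P=> ->; rewrite ?orbT. Qed.

Lemma strip_sym u v W : strip u v W -> strip v u W.
Proof.
elim=> {u v W} [u v uv|u v w W1 W2 uv uW vW wW d12 cW c1 c2 _ s1 _ s2].
  by apply: strip0; rewrite eq_sym.
rewrite (setUC W1) in uW vW wW cW *.
by apply: stripU => //; [rewrite eq_sym|rewrite disjoint_sym|apply: enclosed_sym
  |apply: enclosed_sym|apply: enclosed_sym].
Qed.

(** The end [v] bounds only the second piece at each level, so the induction follows [W2]; when no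
    edge leads into [v], any outside vertex other than [u] can take its place. *)
Lemma strip_move_right u v v' W : strip u v W ->
  (forall x, x \in W -> ~~ e x v) -> v' \notin W -> v' != u -> strip u v' W.
Proof.
move=> sW; elim: sW v' => {u v W} [u v uv v' _ _ v'u|u v w W1 W2 uv uW vW wW d12 cW c1 c2 s1 _ s2 IH2 v' nv v'W v'u].
  by apply: strip0; rewrite eq_sym.
have nv2 x : x \in W2 -> ~~ e x v by move=> xW; apply: nv; rewrite !inE xW !orbT.
have clos u0 (W : {set T}) : (forall x, x \in W -> ~~ e x v) -> enclosed u0 v W -> enclosed u0 v' W.
  move=> nvW c x y xW exy; have := c x y xW exy.
  by case/or3P=> [->|->|/eqP yv]; rewrite ?orbT //; move: (nvW x xW); rewrite -yv exy.
apply: stripU => //; [by rewrite eq_sym|exact: clos|exact: clos|].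
apply: IH2 => //; first by move: v'W; rewrite !inE !negb_or => /and3P[].
by move: v'W; rewrite !inE !negb_or => /and3P[].
Qed.

(** [S] sinks into the first piece at each level: having no edges to [v], it can exchange its end
    [v] for the apex [w], and is then absorbed by [W1] between [u] and [w], down to the empty
    strip. *)
Lemma strip_merge u v W S : strip u v W -> strip u v S ->
  (forall x, x \in S -> ~~ e x v) -> [disjoint S & W] ->
  u \notin S -> v \notin S -> enclosed u v S -> strip u v (S :|: W).
Proof.
move=> sW; elim: sW S => {u v W} [u v uv S|u v w W1 W2 uv uW vW wW d12 cW c1 c2 s1 IH1 s2 _ S sS nv dS uS vS cS].
  by rewrite setU0.
have wS : w \notin S by apply/negP => wS; have := disjointFr dS wS; rewrite !inE eqxx.
have wu : w != u by move: uW; rewrite !inE !negb_or eq_sym => /and3P[].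
have cSuw x y : x \in S -> e x y -> (y \in S) || (y == u).
  move=> xS exy; have := cS x y xS exy; case/or3P=> [->|->|/eqP yv]; rewrite ?orbT //.
  by move: (nv x xS); rewrite -yv exy.
have dS1 : [disjoint S & W1].
  by apply: disjointWr dS; apply/subsetP => x xW; rewrite !inE xW !orbT.
have dS2 : [disjoint S & W2].
  by apply: disjointWr dS; apply/subsetP => x xW; rewrite !inE xW !orbT.
have nw x : x \in S -> ~~ e x w.
  move=> xS; apply/negP => /(cSuw x w xS); rewrite (negbTE wS) /=; exact/negP.
have cSuw' : enclosed u w S.
  by move=> x y xS exy; case/orP: (cSuw x y xS exy) => ->; rewrite ?orbT.
have s1' : strip u w (S :|: W1).
  by apply: IH1 => //; apply: strip_move_right sS _ _ _.
have -> : S :|: (w |: (W1 :|: W2)) = w |: ((S :|: W1) :|: W2).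
  by rewrite setUCA (setUA S).
apply: stripU => //.
- by move: uW; rewrite !inE (negbTE uS).
- by move: vW; rewrite !inE (negbTE vS).
- by move: wW; rewrite !inE (negbTE wS).
- by rewrite -setI_eq0 setIUl setU_eq0 !setI_eq0 dS2.
- move=> x y; rewrite !inE => /or3P[/eqP->|/orP[xS|xW]|xW] exy.
  + have := cW w y; rewrite !inE eqxx => /(_ isT exy).
    by case: (y \in S); case: (y \in W1); case: (y \in W2); case: (y == u); case: (y == v); case: (y == w).
  + have := cSuw x y xS exy; by case: (y \in S); case: (y \in W1); case: (y \in W2); case: (y == u); case: (y == v); case: (y == w).
  + have := cW x y; rewrite !inE xW !orbT => /(_ isT exy).
    by case: (y \in S); case: (y \in W1); case: (y \in W2); case: (y == u); case: (y == v); case: (y == w).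
  + have := cW x y; rewrite !inE xW !orbT => /(_ isT exy).
    by case: (y \in S); case: (y \in W1); case: (y \in W2); case: (y == u); case: (y == v); case: (y == w).
- move=> x y; rewrite !inE => /orP[xS|xW] exy.
  + have := cSuw x y xS exy; by case: (y \in S); case: (y \in W1); case: (y \in W2); case: (y == u); case: (y == v); case: (y == w).
  + have := c1 x y xW exy; by case: (y \in S); case: (y \in W1); case: (y \in W2); case: (y == u); case: (y == v); case: (y == w).
Qed.

(** * Cutting a piece into strips along a tournament *)

Definition tournament (t : rel T) := forall x y, x != y -> t x y = ~~ t y x.

(* For a transitive [t], this says that disjoint edges do not interleave. *)
Definition uncrossed (t : rel T) (D : {set T}) := forall a b c d,
  a \in D -> b \in D -> c \in D -> d \in D -> e a b -> e c d ->
  a != c -> a != d -> b != c -> b != d ->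
  t a c (+) t a d (+) (t b c (+) t b d) = false.

Definition ordered_strip t (u v : T) (W : {set T}) :=
  [/\ tournament t, uncrossed t (W :|: [set u; v]), t u v
    & forall x, x \in W -> t u x /\ t x v].


Lemma uncrossedS t (D D' : {set T}) : D' \subset D -> uncrossed t D -> uncrossed t D'.
Proof. by move=> /subsetP sD unc a b c d /sD aD /sD bD /sD cD /sD dD; apply: unc. Qed.

Lemma ordered_strip_sub t u v (W W' : {set T}) : W' \subset W ->
  ordered_strip t u v W -> ordered_strip t u v W'.
Proof.
move=> sW [tour unc tuv tW]; split=> //; last by move=> x /(subsetP sW)/tW.
by apply: uncrossedS unc; apply: setSU.
Qed.

Lemma ordered_strip_rev t u v W : ordered_strip t u v W ->
  ordered_strip (fun x y => t y x) v u W.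
Proof.
move=> [tour unc tuv tW]; split=> //.
- by move=> x y xy; apply: tour; rewrite eq_sym.
- move=> a b c d aD bD cD dD eab ecd ac ad bc bd.
  rewrite (setUC [set v]) in aD bD cD dD.
  have := unc c d a b cD dD aD bD ecd eab.
  rewrite (eq_sym c) (eq_sym c b) (eq_sym d) (eq_sym d b) ac ad bc bd => /(_ isT isT isT isT).
  by case: (t c a); case: (t c b); case: (t d a); case: (t d b).
- by move=> x /tW[].
Qed.

Lemma subset_sep (A : {set T}) (P : pred T) : [set x in A | P x] \subset A.
Proof. by apply/subsetP => x; rewrite inE => /andP[]. Qed.

(** These are the unions of connected components of the graph induced on [W]. *)
Definition separate (W S : {set T}) :=
  (S \subset W) && [forall x in S, forall y in W, e x y ==> (y \in S)].

Lemma separateP (W S : {set T}) : reflect (S \subset W /\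
  forall x y, x \in S -> y \in W -> e x y -> y \in S) (separate W S).
Proof.
apply: (iffP andP) => [[sW /forall_inP H]|[sW H]]; split=> //.
  by move=> x y xS yW; move/forall_inP: (H x xS) => /(_ y yW)/implyP.
apply/forall_inP => x xS; apply/forall_inP => y yW; apply/implyP; exact: H.
Qed.

Lemma separateD (W S : {set T}) : separate W S -> separate W (W :\: S).
Proof.
move/separateP=> [sW H]; apply/separateP; split; first exact: subsetDl.
move=> x y; rewrite !inE => /andP[xS xW] yW exy; rewrite yW andbT.
by apply: contra xS => yS; apply: H yS xW _; rewrite e_sym.
Qed.

Lemma enclosed_separate u v (W S : {set T}) :
  enclosed u v W -> separate W S -> enclosed u v S.
Proof.
move=> c /separateP[sW H] x y xS exy.
case/or3P: (c x y (subsetP sW x xS) exy) => [yW|->|->]; rewrite ?orbT //.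
by rewrite (H x y).
Qed.

(** A nonempty separate set with this property is a single component. *)
Definition connected_set (W S : {set T}) :=
  forall S', separate W S' -> S' \subset S -> S' != set0 -> S' = S.

(** For an edge [c d] inside [S], [uncrossed] applied to [u a] and [c d] reads [t a c = t a d],
    since [u] precedes both ends. So the vertices of [S] after [a] form a union of components. *)
Lemma connected_constant t u v (W S : {set T}) a : ordered_strip t u v W ->
  u \notin W -> separate W S -> connected_set W S -> a \in W -> a \notin S ->
  e u a -> {in S &, forall x y, t a x = t a y}.
Proof.
move=> [tour unc tuv tW] uW sepS conn aW aS eua x y xS yS.
have [sSW clS] := separateP _ _ sepS.

have uS : u \notin S by apply: contra uW => /(subsetP sSW).
have imp x' y' : x' \in S -> y' \in S -> t a x' -> t a y'.
  move=> xS' yS' tax; have eqS : [set c in S | t a c] = S.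
    apply: conn; last by apply/set0Pn; exists x'; rewrite inE xS'.
      apply/separateP; split; first by apply: subset_trans sSW; apply: subset_sep.
      move=> c d; rewrite !inE => /andP[cS tac] dW ecd.
      have dS := clS c d cS dW ecd; rewrite dS /=.
      have ne z : z \in S -> (u != z) /\ (a != z).
        by move=> zS; split; apply: contraTneq zS => <-.
      have inD z : z \in W -> z \in W :|: [set u; v] by rewrite !inE => ->.
      have uD : u \in W :|: [set u; v] by rewrite !inE eqxx orbT.
      have := unc u a c d uD (inD a aW) (inD c (subsetP sSW c cS)) (inD d dW) eua ecd.
      case: (ne c cS) => -> ->; case: (ne d dS) => -> -> /(_ isT isT isT isT).
      by case: (tW c (subsetP sSW c cS)) => -> _; case: (tW d dW) => -> _; rewrite tac; case: (t a d).
    exact: subset_sep.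
  by move: yS'; rewrite -{1}eqS inE => /andP[].
by apply/idP/idP; exact: imp.
Qed.

(** Edges [u a] and [v b] with distinct [a], [b] in [W] force [t a b]. Here this gives [t x y'] and
    [t x' y], which constancy on components turns into [t x x'] and [t x' x]. *)
Lemma connected_one_sided t u v (W S S' : {set T}) x y x' y' :
  ordered_strip t u v W -> u != v -> u \notin W -> v \notin W ->
  separate W S -> separate W S' -> connected_set W S -> connected_set W S' ->
  [disjoint S & S'] -> x \in S -> y \in S -> x' \in S' -> y' \in S' ->
  e u x -> e v y -> e u x' -> e v y' -> False.
Proof.
move=> os uv uW vW sS sS' cS cS' dSS xS yS xS' yS' eux evy eux' evy'.
have [tour unc tuv tW] := os.
have [sSW _] := separateP _ _ sS; have [sSW' _] := separateP _ _ sS'.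
have inD z : z \in W -> z \in W :|: [set u; v] by rewrite !inE => ->.
have uD : u \in W :|: [set u; v] by rewrite !inE eqxx orbT.
have vD : v \in W :|: [set u; v] by rewrite !inE eqxx !orbT.
have neq z z' : z \in S -> z' \in S' -> z != z'.
  by move=> zS zS'; apply: contraTneq zS' => <-; rewrite (disjointFr dSS).
have neW z z' : z \in W -> z' \notin W -> z' != z.
  by move=> zW; apply: contraNneq => ->.
have cross a b : a \in W -> b \in W -> a != b -> e u a -> e v b -> t a b.
  move=> aW bW ab eua evb.
  have := unc u a v b uD (inD a aW) vD (inD b bW) eua evb.
  rewrite uv ab (neW b u) // (eq_sym a v) (neW a v) // => /(_ isT isT isT isT).
  by rewrite tuv (tW b bW).1 (tW a aW).2; case: (t a b).
have W1 := subsetP sSW; have W2 := subsetP sSW'.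
have t1 : t x y' by apply: cross; auto.
have t2 : t x' y by apply: cross; auto; rewrite eq_sym; auto.
have xS'n : x \notin S' by rewrite (disjointFr dSS).
have x'Sn : x' \notin S by rewrite (disjointFl dSS).
have := connected_constant os uW sS' cS' (W1 _ xS) xS'n eux yS' xS'.
have := connected_constant os uW sS cS (W2 _ xS') x'Sn eux' yS xS.
by rewrite t1 t2 (tour x x') ?neq // => <-.
Qed.

Lemma separate_connected (W S : {set T}) : separate W S -> S != set0 ->
  exists S', [/\ separate W S', connected_set W S', S' \subset S & S' != set0].
Proof.
move=> sS S0; have PS : separate W S && (S != set0) by rewrite sS.
have [S' /minsetP[/andP[sS' S'0] minS'] sub] :=
  @minset_exists _ (fun A => separate W A && (A != set0)) S PS.
exists S'; split=> // A sA AS A0; apply: minS' => //; by rewrite sA.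
Qed.

Lemma enclosedD u v (W : {set T}) w (W' : {set T}) : enclosed u v W ->
  W' \subset W :\ w -> (forall x y, x \in W' -> y \in W :\ w -> e x y -> y \in W') ->
  (forall x, x \in W' -> ~~ e x v) -> enclosed u w W'.
Proof.
move=> c sW cl nv x y xW exy; have := subsetP sW x xW; rewrite !inE => /andP[xw xW0].
case/or3P: (c x y xW0 exy) => [yW|->|/eqP yv]; rewrite ?orbT //; last first.
  by move: (nv x xW); rewrite -yv exy.
have [->|yw] := eqVneq y w; first by rewrite !orbT.
by rewrite (cl x y xW) ?inE ?yw ?exy.
Qed.

(** The apex is [w], and the pieces are the vertices before and after it. Constancy along edges
    keeps the pieces from touching; the conditions on [u] and [v] keep each end away from the
    opposite piece. *)
Lemma strip_split t u v w (W : {set T}) :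
  ordered_strip t u v W -> enclosed u v W -> u != v -> u \notin W -> v \notin W ->
  w \in W ->
  (forall c d, c \in W :\ w -> d \in W :\ w -> e c d -> t w c = t w d) ->
  (forall y, y \in W :\ w -> e u y -> t y w) ->
  (forall y, y \in W :\ w -> e v y -> t w y) ->
  (forall t u v (W' : {set T}), W' \subset W :\ w -> ordered_strip t u v W' ->
     enclosed u v W' -> u != v -> u \notin W' -> v \notin W' -> strip u v W') ->
  strip u v W.
Proof.
move=> os cW uv uW vW wW tconst tu tv IH; have [tour unc tuv tW] := os.
pose W1 := [set y in W :\ w | t y w]; pose W2 := [set y in W :\ w | t w y].
have neW z z' : z \in W -> z' \notin W -> z' != z.
  by move=> zW; apply: contraNneq => ->.
have WE : W = w |: (W1 :|: W2).
  apply/setP => y; rewrite !inE; have [->|yw] := eqVneq y w; first by rewrite wW.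
  by rewrite -andb_orr (tour y w yw) orNb andbT.
have wW12 : w \notin W1 :|: W2 by rewrite !inE eqxx.
have d12 : [disjoint W1 & W2].
  rewrite -setI_eq0; apply/eqP/setP => y; rewrite !inE.
  by have [//|yw] := eqVneq y w; rewrite (tour y w yw); case: (t w y); rewrite ?andbF.
have s1 : W1 \subset W :\ w by apply: subset_sep.
have s2 : W2 \subset W :\ w by apply: subset_sep.
have s1W : W1 \subset W by apply: subset_trans s1 (subD1set _ _).
have s2W : W2 \subset W by apply: subset_trans s2 (subD1set _ _).
have inW1 y : y \in W1 = (y \in W :\ w) && t y w by rewrite inE.
have inW2 y : y \in W2 = (y \in W :\ w) && t w y by rewrite inE.
have nw y : y \in W :\ w -> y != w by rewrite !inE => /andP[].
have e1 : enclosed u w W1.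
  apply: (enclosedD cW s1) => [x y|x].
    rewrite !inW1 => /andP[xW txw] yW exy; rewrite yW /=.
    by rewrite (tour y w) ?nw // -(tconst x y) // -tour // nw.
  rewrite inW1 => /andP[xW txw]; apply/negP; rewrite e_sym => /(tv x xW).
  by rewrite (tour w x) ?txw // eq_sym nw.
have e2 : enclosed w v W2.
  apply: enclosed_sym; apply: (enclosedD (enclosed_sym cW) s2) => [x y|x].
    rewrite !inW2 => /andP[xW txw] yW exy; rewrite yW /=.
    by rewrite -(tconst x y).
  rewrite inW2 => /andP[xW txw]; apply/negP; rewrite e_sym => /(tu x xW).
  by rewrite (tour x w) ?txw // nw.
have sub z (W' : {set T}) : W' \subset W -> z \notin W -> z \notin W'.
  by move=> sWW; apply: contra => /(subsetP sWW).
have uw : u != w by apply: neW.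
have wv : w != v by rewrite eq_sym; apply: neW.
have [w1 w2] : w \notin W1 /\ w \notin W2 by rewrite inW1 inW2 !inE eqxx.
rewrite WE; apply: stripU; rewrite -?WE //.
- apply: (IH t) => //; last exact: sub.
  split=> //; last 2 first.
  + exact: (tW w wW).1.
  + by move=> x xW; split; [apply: (tW x (subsetP s1W x xW)).1|move: xW; rewrite inW1 => /andP[]].
  apply: uncrossedS unc; apply/subsetP => x; rewrite in_setU in_set2.
  case/or3P => [/(subsetP s1W) xW|/eqP->|/eqP->]; by rewrite !inE ?xW ?wW ?eqxx ?orbT.
- apply: (IH t) => //; last exact: sub.
  split=> //; last 2 first.
  + exact: (tW w wW).2.
  + by move=> x xW; split; [move: xW; rewrite inW2 => /andP[]|apply: (tW x (subsetP s2W x xW)).2].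
  apply: uncrossedS unc; apply/subsetP => x; rewrite in_setU in_set2.
  case/or3P => [/(subsetP s2W) xW|/eqP->|/eqP->]; by rewrite !inE ?xW ?wW ?eqxx ?orbT.
Qed.

(** The apex is the last neighbour of [u]; as [t] may fail to be transitive, last means having the
    fewest vertices after it. *)
Lemma strip_at_neighbour t u v x (W : {set T}) :
  ordered_strip t u v W -> enclosed u v W -> u != v -> u \notin W -> v \notin W ->
  connected_set W W -> x \in W -> e u x ->
  (forall t u v (W' : {set T}), W' \proper W -> ordered_strip t u v W' ->
     enclosed u v W' -> u != v -> u \notin W' -> v \notin W' -> strip u v W') ->
  strip u v W.
Proof.
move=> os cW uv uW vW conn xW eux IH; have [tour unc tuv tW] := os.
have Px : (x \in W) && e u x by rewrite xW.
pose after w := [set y in W :\ w | t w y].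
have inaf w y : y \in after w = (y \in W :\ w) && t w y by rewrite inE.
have [w /andP[wW euw] wmin] :=
  @arg_minnP _ x (fun y => (y \in W) && e u y) (fun w => #|after w|) Px.
have neW z z' : z \in W -> z' \notin W -> z' != z.
  by move=> zW; apply: contraNneq => ->.
have inD z : z \in W -> z \in W :|: [set u; v] by rewrite !inE => ->.
have uD : u \in W :|: [set u; v] by rewrite !inE eqxx orbT.
have vD : v \in W :|: [set u; v] by rewrite !inE eqxx !orbT.
have const z : z \in W -> e u z ->
    forall c d, c \in W :\ z -> d \in W :\ z -> e c d -> t z c = t z d.
  move=> zW euz c d; rewrite !inE => /andP[cz cW'] /andP[dz dW] ecd.
  have := unc u z c d uD (inD z zW) (inD c cW') (inD d dW) euz ecd.
  rewrite (neW c u) // (neW d u) // (eq_sym z c) (eq_sym z d) cz dz.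
  move=> /(_ isT isT isT isT).
  by rewrite (tW c cW').1 (tW d dW).1; case: (t z c); case: (t z d).
apply: (strip_split os cW uv uW vW wW (const w wW euw)) => [y|y|t' u' v' W' sW'].
- rewrite !inE => /andP[yw yW] euy; rewrite (tour y w yw); apply/negP => twy.
  have yaf : y \in after w by rewrite inaf !inE yw yW.
  have nwaf : w \notin after y.
    by rewrite inaf !inE (eq_sym w) yw wW (tour y w yw) twy.
  (* The difference is closed under the edges of [W] and misses [w], so by connectedness it is
     empty. As [y] lies in [after w] but not in [after y], this contradicts the choice of [w]. *)
  suff /eqP : after y :\: after w = set0.
    rewrite setD_eq0 => sub; have : #|after y| < #|after w|.
      apply: proper_card; apply/properP; split=> //; exists y => //.
      by rewrite inaf !inE eqxx.
    by rewrite ltnNge wmin // yW.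
  apply/eqP; apply: contraT => Z0; have := conn (after y :\: after w).
  move=> /(_ _ _ Z0) HZ; suff E : after y :\: after w = W.
    by move: wW; rewrite -E !inE eqxx /= (negbTE (_ : ~~ t y w)) ?andbF // (tour y w yw) twy.
  apply: HZ; last first.
    by apply: subset_trans (subsetDl _ _) _; apply: subset_trans (subset_sep _ _) (subD1set _ _).
  apply/separateP; split.
    by apply: subset_trans (subsetDl _ _) _; apply: subset_trans (subset_sep _ _) (subD1set _ _).
  move=> a b; rewrite !in_setD => /andP[aw ay] bW eab.
  have [aWy tya] : a \in W :\ y /\ t y a by move: ay; rewrite inaf => /andP[].
  have [ay' aW] : a != y /\ a \in W by move: aWy; rewrite !inE => /andP[].
  have aw' : a != w by apply: contraNneq nwaf => <-.
  have aWw : a \in W :\ w by rewrite !inE aw'.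
  have twa : t w a = false by move: aw; rewrite inaf aWw /= => /negbTE.
  have bw : b != w.
    apply/eqP => bw; have wWy : w \in W :\ y by rewrite !inE (eq_sym w) yw.
    by move: nwaf; rewrite inaf wWy -(const y yW euy a w aWy wWy) ?tya // -bw.
  have by' : b != y.
    apply/eqP => bY; have yWw : y \in W :\ w by rewrite !inE yw.
    by move: twy; rewrite -(const w wW euw a y aWw yWw) ?twa // -bY.
  have bWy : b \in W :\ y by rewrite !inE by'.
  have bWw : b \in W :\ w by rewrite !inE bw.
  rewrite !inaf bWy bWw -(const y yW euy a b aWy bWy eab) tya.
  by rewrite -(const w wW euw a b aWw bWw eab) twa.
- rewrite !inE => /andP[yw yW] evy.
  have := unc u w v y uD (inD w wW) vD (inD y yW) euw evy.
  rewrite uv (neW y u) // (eq_sym w v) (neW w v) // (eq_sym w y) yw.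
  by rewrite tuv (tW y yW).1 (tW w wW).2 => /(_ isT isT isT isT); case: (t w y).
- apply: IH; apply: sub_proper_trans sW' _; exact: properD1.
Qed.

(** With no edges to the ends, an arbitrary [x] can be the apex with an empty first piece, provided
    the tournament can be changed so that [x] precedes the rest of [W]. *)
Lemma strip_isolated t u v x (W : {set T}) :
  ordered_strip t u v W -> enclosed u v W -> u != v -> u \notin W -> v \notin W ->
  x \in W -> (forall y, y \in W -> ~~ e u y /\ ~~ e v y) ->
  (forall t u v (W' : {set T}), W' \proper W -> ordered_strip t u v W' ->
     enclosed u v W' -> u != v -> u \notin W' -> v \notin W' -> strip u v W') ->
  strip u v W.
Proof.
move=> [tour unc tuv tW] cW uv uW vW xW iso IH.
have neW z z' : z \in W -> z' \notin W -> z' != z.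
  by move=> zW; apply: contraNneq => ->.
have clos y z : y \in W -> e y z -> z \in W.
  move=> yW eyz; have [/negP nu /negP nv] := iso y yW.
  by case/or3P: (cW y z yW eyz) => // /eqP zz; [case: nu|case: nv]; rewrite -zz e_sym.
(* Switching: [s] marks the vertices before [x], and [t'] reverses every pair with exactly one
   marked vertex. This puts [x] first, and in the sum of [uncrossed] each [s] occurs twice and
   cancels. The end [v], which meets no edge here, is put last by decree. *)
pose s y := (y != x) && ~~ t x y.
pose t' y z := if z == v then y != v else (y != v) && (t y z (+) s y (+) s z).
have WE : W = x |: (set0 :|: (W :\ x)) by rewrite set0U setD1K.
have xv : x != v by rewrite eq_sym; apply: neW.
have eE : enclosed x v (W :\ x).
  move=> y z; rewrite !inE => /andP[yx yW] eyz; rewrite (clos y z) // andbT.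
  by have [->|] := eqVneq z x; rewrite ?eqxx.
rewrite WE; apply: stripU; rewrite -?WE ?in_setU ?in_set0 ?setD11 //=.
- by rewrite -setI_eq0 set0I.
- by move=> y z; rewrite inE.
- by apply: strip0; apply: neW.
- apply: (IH t'); rewrite ?properD1 ?setD11 //; last by rewrite !inE negb_and vW orbT.
  split.
  + move=> y z yz; rewrite /t'; have [zv|zv] := eqVneq z v.
      by move: yz; rewrite zv => yv; rewrite yv (negbTE yv).
    have [//|yv] := eqVneq y v; rewrite ?zv /= (tour y z yz).
    by case: (t z y); case: (s y); case: (s z).
  + move=> a b c d aD bD cD dD eab ecd ac ad bc bd.
    have nov y z : y \in W :\ x :|: [set x; v] -> z \in W :\ x :|: [set x; v] -> e y z ->
        y \in W.
      rewrite !inE => yD zD eyz; have [/eqP yv|yv] := boolP (y == v); last first.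
        move: yD; rewrite (negbTE yv) orbF; by case: eqP => [->|_]; rewrite ?orbF.
      have zW : z \in W.
        move: zD; have [zv|zv] := eqVneq z v; first by move: eyz; rewrite yv zv e_irr.
        by rewrite orbF; case: eqP => [->|_]; rewrite ?orbF.
      by have := clos z y zW; rewrite e_sym => /(_ eyz).
    have aW := nov a b aD bD eab; have bW : b \in W by apply: (nov b a) => //; rewrite e_sym.
    have cW' := nov c d cD dD ecd; have dW : d \in W by apply: (nov d c) => //; rewrite e_sym.
    have t'E y z : y \in W -> z \in W -> t' y z = t y z (+) s y (+) s z.
      by move=> yW zW; rewrite /t' eq_sym (negbTE (neW z v zW vW)) eq_sym neW.
    rewrite !t'E //.
    have := unc a b c d; rewrite !in_setU aW bW cW' dW eab ecd ac ad bc bd.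
    move=> /(_ isT isT isT isT isT isT isT isT isT isT).
    by case: (t a c); case: (t a d); case: (t b c); case: (t b d); case: (s a); case: (s b); case: (s c); case: (s d).
  + by rewrite /t' eqxx xv.
  + move=> y; rewrite !inE => /andP[yx yW].
    rewrite /t' eqxx (negbTE (_ : y != v)) ?xv; last by rewrite eq_sym neW.
    by rewrite /s eqxx yx /= addbF; case: (t x y).
Qed.

(** Induction on the size of [W]. If [W] is disconnected, one of two components is attached to at
    most one end, and it is split off and merged back. If [W] is connected, the apex is a neighbour
    of [u], or of [v] after reversal, or no vertex is attached to an end. *)
Lemma ordered_strip_strip t u v (W : {set T}) :
  ordered_strip t u v W -> enclosed u v W -> u != v -> u \notin W -> v \notin W ->
  strip u v W.
Proof.
elim: {W}_.+1 {-2}W (ltnSn #|W|) t u v => // n IHn W Wn t u v os cW uv uW vW.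
have IH t' u' v' (W' : {set T}) : W' \proper W -> ordered_strip t' u' v' W' ->
     enclosed u' v' W' -> u' != v' -> u' \notin W' -> v' \notin W' -> strip u' v' W'.
  by move=> /proper_card W'W; apply: IHn; apply: leq_trans W'W _.
have [->|W0] := eqVneq W set0; first exact: strip0.
have sub z (W' : {set T}) : W' \subset W -> z \notin W -> z \notin W'.
  by move=> sWW; apply: contra => /(subsetP sWW).
have dec (S : {set T}) : separate W S -> S != set0 -> S != W ->
    [forall x in S, ~~ e v x] || [forall x in S, ~~ e u x] -> strip u v W.
  move=> sS S0 SW one; have [sSW _] := separateP _ _ sS.
  have pS : S \proper W by rewrite properEneq SW.
  have pD : W :\: S \proper W.
    rewrite properEneq subsetDl andbT; apply: contra S0 => /eqP DW.
    have : W :&: S = set0 by rewrite -DW setDE -setIA (setIC _ S) setICr setI0.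
    by rewrite (setIidPr sSW) => ->.
  have WE : W = S :|: (W :\: S) by rewrite setUC -{1}(setID W S) (setIidPr sSW) setUC.
  have dS : [disjoint S & W :\: S] by rewrite -setI_eq0 setIDA setIC -setIDA setDv setI0.
  have st1 : strip u v S.
    by apply: (IH t) => //; [exact: ordered_strip_sub os|exact: enclosed_separate sS|exact: sub..].
  have st2 : strip u v (W :\: S).
    apply: (IH t) => //; [exact: ordered_strip_sub (subsetDl _ _) os
      |exact: enclosed_separate (separateD sS)|exact: sub (subsetDl _ _) _..].
  have cS := enclosed_separate cW sS.
  rewrite WE; case/orP: one => /forall_inP one.
    by apply: strip_merge => //; [move=> x xS; rewrite e_sym one|exact: sub..].
  apply: strip_sym; apply: strip_merge; rewrite 1?disjoint_sym //.
  - exact: strip_sym.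
  - exact: strip_sym.
  - by move=> x xS; rewrite e_sym one.
  - by rewrite disjoint_sym.
  - exact: sub.
  - exact: sub.
  - exact: enclosed_sym.
have [/existsP[S /and3P[sS S0 SW]]|/existsPn conn] :=
  boolP [exists S : {set T}, [&& separate W S, S != set0 & S != W]].
  have [S1 [sS1 cS1 sub1 S10]] := separate_connected sS S0.
  have S1W : S1 != W.
    apply: contra SW => /eqP S1W; rewrite eqEsubset -{2}S1W sub1 andbT.
    by have [] := separateP _ _ sS.
  have [one1|] := boolP ([forall x in S1, ~~ e v x] || [forall x in S1, ~~ e u x]).
    exact: dec sS1 S10 S1W one1.
  rewrite negb_or => /andP[/forall_inPn[y1 y1S /negPn evy1] /forall_inPn[x1 x1S /negPn eux1]].
  have D0 : W :\: S1 != set0.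
    rewrite setD_eq0; apply: contra S1W => WS1; rewrite eqEsubset WS1 andbT.
    by have [] := separateP _ _ sS1.
  have [S2 [sS2 cS2 sub2 S20]] := separate_connected (separateD sS1) D0.
  have dS12 : [disjoint S1 & S2].
    by rewrite disjoint_sym; apply: disjointWl sub2 _; rewrite -setI_eq0 setIDAC setDIl setDv setI0.
  have S2W : S2 != W.
    apply: contraNneq S10 => S2W; rewrite -subset0; apply/subsetP => x xS1.
    have := disjointFr dS12 xS1; rewrite S2W.
    by have [/subsetP/(_ x xS1)->] := separateP _ _ sS1.
  have [one2|] := boolP ([forall x in S2, ~~ e v x] || [forall x in S2, ~~ e u x]).
    exact: dec sS2 S20 S2W one2.
  rewrite negb_or => /andP[/forall_inPn[y2 y2S /negPn evy2] /forall_inPn[x2 x2S /negPn eux2]].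
  by case: (connected_one_sided os uv uW vW sS1 sS2 cS1 cS2 dS12 x1S y1S x2S y2S eux1 evy1 eux2 evy2).
have cWW : connected_set W W.
  by move=> S' sS' _ S'0; apply/eqP; move: (conn S'); rewrite sS' S'0 /= => /negPn.
have [/exists_inP[x xW eux]|/exists_inPn nu] := boolP [exists x in W, e u x].
  exact: strip_at_neighbour os cW uv uW vW cWW xW eux IH.
have [/exists_inP[x xW evx]|/exists_inPn nv] := boolP [exists x in W, e v x].
  apply: strip_sym; apply: strip_at_neighbour (ordered_strip_rev os) _ _ vW uW cWW xW evx IH.
    exact: enclosed_sym.
  by rewrite eq_sym.
have /set0Pn[x xW] := W0.
by apply: strip_isolated os cW uv uW vW xW _ IH => y yW; rewrite nu ?nv.
Qed.
End Strip.

(** * Colourings of a strip that defeat every guess *)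

Lemma subset_of_card (I : finType) (A : {set I}) n : n <= #|A| ->
  exists2 B : {set I}, B \subset A & #|B| = n.
Proof.
move/card_geqP => [s [us ss sA]]; exists [set x in s].
  by apply/subsetP => x; rewrite inE => /sA.
by rewrite cardsE (card_uniqP us).
Qed.

Lemma card_bigcup_leq (I J : finType) (A : {set I}) (F : I -> {set J}) n :
  (forall i, i \in A -> #|F i| <= n) -> #|\bigcup_(i in A) F i| <= #|A| * n.
Proof.
move=> Fn; rewrite -sum_nat_const.
elim/big_rec2: _ => [|i m B iA Bm]; first by rewrite cards0.
by apply: leq_trans (leq_card_setU _ _) _; apply: leq_add => //; apply: Fn.
Qed.

Lemma exists_outside (I J : finType) (A : {set I}) (B : {set J}) (F : I -> {set J}) n :
  (forall i, i \in A -> #|F i| <= n) -> #|A| * n < #|B| ->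
  exists2 y, y \in B & forall i, i \in A -> y \notin F i.
Proof.
move=> Fn lt; have /subsetPn[y yB yF] : ~~ (B \subset \bigcup_(i in A) F i).
  by apply/negP => /subset_leq_card; rewrite leqNgt (leq_ltn_trans (card_bigcup_leq Fn)).
by exists y => // i iA; apply: contra yF => yFi; apply/bigcupP; exists i.
Qed.

Section Colouring.
Variables (T : finType) (e : rel T) (S : finType) (g : T -> (T -> S) -> S).
Hypothesis e_sym : symmetric e.
Hypothesis e_irr : irreflexive e.
Hypothesis g_local : forall x phi psi, (forall y, e x y -> phi y = psi y) ->
  g x phi = g x psi.
Variable Q : {set S}.
Hypothesis card_Q : #|Q| = 7.
Hypothesis card_S : 350 * 49 < #|S|.

Definition unguessed (W : {set T}) (phi : T -> S) :=
  forall x, x \in W -> g x phi != phi x.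

Definition seen_as (u : T) (W : {set T}) (phi psi : T -> S) :=
  forall x, x \in W -> e u x -> phi x = psi x.

Lemma unguessed_enclosed u v W phi psi : enclosed e u v W ->
  {in W, phi =1 psi} -> phi u = psi u -> phi v = psi v ->
  unguessed W phi -> unguessed W psi.
Proof.
move=> cW eqW equ eqv gW x xW; rewrite -(eqW x xW) -(@g_local x phi) ?gW // => y exy.
by case/or3P: (cW x y xW exy) => [/eqW|/eqP->|/eqP->].
Qed.

(* [lam A b] is what [u] sees when its own colour is some element of [A] and [v]
   has colour [b].  It may depend on the pair [A], but not on the choice of the
   element, and symmetrically for [rho]. *)
Definition grid (u v : T) (W : {set T}) :=
  forall Xu Xv : {set S}, #|Xu| * #|Xv| <= 350 ->
  exists lam rho : {set S} -> S -> T -> S,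
  forall (A B : {set S}) a b, A \subset Xu -> B \subset Xv ->
    #|A| <= 2 -> #|B| <= 2 -> a \in A -> b \in B ->
  exists phi, [/\ phi u = a, phi v = b, unguessed W phi,
    seen_as u W phi (lam A b) & seen_as v W phi (rho B a)].

(* The colour [z] of [w] has to be chosen before the colouring of [W] is known,
   for all colours [a] of [u] at once; the point is that what [w] can see in [W]
   is one of the [#|Q|] views [view (X a) B i], and that these depend on a pair [B]
   containing [z] but not on [z] itself.  The list [L] bounds the number of bad
   values of [i] by 2, as needed to extend a colouring along a path. *)
Definition fan (u w : T) (W : {set T}) :=
  exists view : {set S} -> {set S} -> S -> T -> S,
  forall z (A : {set S}) (X : S -> {set S}) (L : {set S}), #|A| <= 2 ->
    (forall a, a \in A -> #|X a| <= 50) -> (forall a, a \in A -> z \in X a) ->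
    L \subset Q -> #|L| = 3 ->
  exists i lam, i \in L /\ forall a (B : {set S}), a \in A ->
    B \subset X a -> #|B| <= 2 -> z \in B ->
  exists phi, [/\ phi u = a, phi w = z, unguessed W phi,
    seen_as u W phi lam & seen_as w W phi (view (X a) B i)].

Lemma grid_sym u v W : grid u v W -> grid v u W.
Proof.
move=> H Xv Xu; rewrite mulnC => /H[lam [rho Hlr]].
exists rho, lam => B A b a *; have [] := Hlr A B a b => // phi [? ? ? ? ?].
by exists phi.
Qed.

Lemma S_inhabited : exists s : S, s \in Q.
Proof. by apply/set0Pn; rewrite -card_gt0 card_Q. Qed.

Lemma grid0 u v : u != v -> grid u v set0.
Proof.
have [s _] := S_inhabited => uv Xu Xv _; exists (fun _ _ _ => s), (fun _ _ _ => s).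
move=> A B a b _ _ _ _ _ _; exists (fun x => if x == u then a else b).
split; rewrite ?eqxx // 1?eq_sym ?(negbTE uv) //; by move=> x; rewrite inE.
Qed.

Lemma fan0 u w : u != w -> fan u w set0.
Proof.
have [s _] := S_inhabited => uw; exists (fun _ _ _ _ => s) => z A X L _ _ _ _ cL.
have /set0Pn[i iL] : L != set0 by rewrite -card_gt0 cL.
exists i, (fun _ => s); split=> // a B _ _ _ _; exists (fun x => if x == u then a else z).
split; rewrite ?eqxx // 1?eq_sym ?(negbTE uw) //; by move=> x; rewrite inE.
Qed.

(** The index [i] of the view that [w] gets is the colour of [c] itself. That colour ranges over the
    7 elements of [Q] and the colour of [w] over at most 50, whence the product 350 in [grid]. *)
Lemma fanU u w c (W1 W2 : {set T}) :
  u != w -> u \notin c |: (W1 :|: W2) -> w \notin c |: (W1 :|: W2) ->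
  c \notin W1 :|: W2 -> [disjoint W1 & W2] ->
  enclosed e u w (c |: (W1 :|: W2)) -> enclosed e u c W1 -> enclosed e c w W2 ->
  fan u c W1 -> grid c w W2 -> fan u w (c |: (W1 :|: W2)).
Proof.
move=> uw; rewrite !in_setU !in_set1 !negb_or => /and3P[uc uW1 uW2] /and3P[wc wW1 wW2].
move=> /andP[cW1 cW2] d12 encl encl1 encl2 [view1 Hview1] grid2.
have [s _] := S_inhabited.
have /fin_all_exists[lr Hlr] (X : {set S}) : exists lr : _ * _, #|X| <= 50 ->
  forall (A B : {set S}) a b, A \subset Q -> B \subset X ->
    #|A| <= 2 -> #|B| <= 2 -> a \in A -> b \in B ->
  exists phi, [/\ phi c = a, phi w = b, unguessed W2 phi,
    seen_as c W2 phi (lr.1 A b) & seen_as w W2 phi (lr.2 B a)].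
  have [X50|] := leqP #|X| 50; last by exists (fun _ _ _ => s, fun _ _ _ => s).
  have [|lam [rho H]] := grid2 Q X; first by rewrite card_Q (leq_mul2l 7 _ 50).
  by exists (lam, rho).
exists (fun X B i x => if x == c then i else (lr X).2 B i x).
move=> z A X L cA cX zX LQ cL.
pose solved a i := exists lam, forall al (B : {set S}), al \in A ->
    B \subset Q -> #|B| <= 2 -> a \in B ->
  exists phi, [/\ phi u = al, phi c = a, unguessed W1 phi,
    seen_as u W1 phi lam & seen_as c W1 phi (view1 Q B i)].
(* Three unsolved indices would form a list to which the fan on [W1] applies, and it would solve one
   of them. *)
have bad2 a : a \in L -> #|[set i in Q | ~~ `[< solved a i >]]| <= 2.
  move=> aL; rewrite leqNgt; apply/negP => /subset_of_card[L' L'bad cL'].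
  have L'Q : L' \subset Q by apply: subset_trans L'bad (subset_sep _ _).
  have [||i [lam [iL' Hi]]] := Hview1 a A (fun _ => Q) L' cA _ _ L'Q cL'.
  - by rewrite card_Q.
  - by move=> *; apply: (subsetP LQ).
  have := subsetP L'bad i iL'; rewrite inE => /andP[_ /asboolPn]; apply.
  by exists lam.
(* The three colours of [L] exclude at most two indices each, and 3 * 2 < 7. *)
have [|i2 i2Q Hi2] := @exists_outside _ _ L Q _ 2 bad2; first by rewrite cL card_Q.
pose psi al A1 x := if x == u then al else if x == w then z else
  if x \in W1 then view1 Q A1 i2 x else (lr (X al)).1 A1 z x.
pose hit al a := [forall A1 : {set S},
  [&& A1 \subset Q, #|A1| <= 2 & a \in A1] ==> (g c (psi al A1) == a)].
(* What [c] sees depends on the pair only: if [a] and [a'] were both hit, the guess of [c] for their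
   common pair would equal both. So at most two colours of [u] rule out at most two of the three
   colours in [L]. *)
have hit1 al : al \in A -> #|[set a in Q | hit al a]| <= 1.
  move=> _; rewrite leqNgt; apply/negP => /card_gt1P[a [a' [+ + aa']]].
  rewrite !inE => /andP[aQ /forallP/(_ [set a; a'])] + /andP[a'Q /forallP/(_ [set a; a'])].
  rewrite subUset !sub1set aQ a'Q cards2 !inE !eqxx orbT.
  by case: (_ != _) => /=; move=> /eqP-> /eqP E; rewrite E eqxx in aa'.
have [|a aL Ha] := @exists_outside _ _ A L _ 1 hit1.
  by rewrite cL muln1 ltnS.
have aQ := subsetP LQ a aL.
have [lam Hlam] : solved a i2.
  by have := Hi2 a aL; rewrite inE i2Q /= negbK => /asboolP.
exists a, (fun x => if x == c then a else lam x); split=> // al B alA BX cB zB.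
have := Ha al alA; rewrite inE aQ /= negb_forall => /existsP[A1].
rewrite negb_imply => /andP[/and3P[A1Q cA1 aA1] nguess].
have [phi1 [p1u p1c p1W p1su p1sc]] := Hlam al A1 alA A1Q cA1 aA1.
have [phi2 [p2c p2w p2W p2sc p2sw]] :=
  Hlr (X al) (cX al alA) A1 B a z A1Q BX cA1 cB aA1 zB.
pose phi x := if x \in W1 then phi1 x else if x \in W2 then phi2 x else
  if x == c then a else if x == u then al else z.
have phiu : phi u = al by rewrite /phi (negbTE uW1) (negbTE uW2) (negbTE uc) eqxx.
have phiw : phi w = z.
  by rewrite /phi (negbTE wW1) (negbTE wW2) (negbTE wc) eq_sym (negbTE uw).
have phic : phi c = a by rewrite /phi (negbTE cW1) (negbTE cW2) eqxx.
have phi1E : {in W1, phi1 =1 phi} by move=> x xW; rewrite /phi xW.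
have phi2E : {in W2, phi2 =1 phi}.
  by move=> x xW; rewrite /phi xW (disjointFl d12 xW).
have notc x : x \in W1 :|: W2 -> (x == c) = false.
  by apply: contraTF => /eqP->; rewrite in_setU negb_or cW1.
exists phi; split=> //.
- move=> x; rewrite !in_setU in_set1 => /or3P[/eqP->|xW|xW].
  + rewrite phic; have <- : g c (psi al A1) = g c phi; last exact: nguess.
    apply: g_local => y ecy; rewrite /psi.
    have [->|yu] := eqVneq y u; first by rewrite phiu.
    have [->|yw] := eqVneq y w; first by rewrite phiw.
    have := encl c y; rewrite !in_setU !in_set1 eqxx (negbTE yu) (negbTE yw) !orbF.
    move=> /(_ isT ecy); case: eqP => [yc|_ /=]; first by move: ecy; rewrite yc e_irr.
    move=> yW; case: ifP => yW1; first by rewrite -phi1E // p1sc.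
    have yW2 : y \in W2 by move: yW; rewrite yW1.
    by rewrite -phi2E // p2sc.
  + by apply: (unguessed_enclosed encl1 phi1E _ _ p1W xW); rewrite ?phiu ?phic.
  + by apply: (unguessed_enclosed encl2 phi2E _ _ p2W xW); rewrite ?phiw ?phic.
- move=> x; rewrite !in_setU in_set1 => /or3P[/eqP->|xW|xW] eux.
  + by rewrite eqxx.
  + by rewrite notc ?in_setU ?xW // -phi1E // p1su.
  + have := encl2 x u xW; rewrite e_sym (negbTE uc) (negbTE uw) (negbTE uW2) => /(_ eux).
    by [].
- move=> x; rewrite !in_setU in_set1 => /or3P[/eqP->|xW|xW] ewx.
  + by rewrite eqxx.
  + have := encl1 x w xW; rewrite e_sym (negbTE wc) eq_sym (negbTE uw) (negbTE wW1) => /(_ ewx).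
    by [].
  + by rewrite notc ?in_setU ?xW ?orbT // -phi2E // p2sw.
Qed.

(** One colour [z] of the apex is fixed for all colours of [u] in [Xu] and of [v] in [Xv]. The two
    fans reduce what [w] sees in the pieces to 7 * 7 = 49 index pairs. *)
Lemma gridU u v w (W1 W2 : {set T}) :
  u != v -> u \notin w |: (W1 :|: W2) -> v \notin w |: (W1 :|: W2) ->
  w \notin W1 :|: W2 -> [disjoint W1 & W2] ->
  enclosed e u v (w |: (W1 :|: W2)) -> enclosed e u w W1 -> enclosed e w v W2 ->
  fan u w W1 -> fan v w W2 -> grid u v (w |: (W1 :|: W2)).
Proof.
move=> uv; rewrite !in_setU !in_set1 !negb_or => /and3P[uw uW1 uW2] /and3P[vw vW1 vW2].
move=> /andP[wW1 wW2] d12 encl encl1 encl2 [view1 Hview1] [view2 Hview2] Xu Xv cX.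
have [s _] := S_inhabited.
have [L LQ cL] : exists2 L : {set S}, L \subset Q & #|L| = 3.
  by apply: subset_of_card; rewrite card_Q.
pose psi (ctx : S * S) X B (i : S * S) x := if x == u then ctx.1 else if x == v then ctx.2 else
  if x \in W1 then view1 X B i.1 x else view2 X B i.2 x.
pose good ctx z (X : {set S}) := [&& #|X| <= 50, z \in X &
  [forall i in finset.setX Q Q, exists B : {set S},
    [&& B \subset X, #|B| <= 2, z \in B & g w (psi ctx X B i) != z]]].
(* If no colour were good, each [z] in [X] would have an index pair [h z] for which it is guessed
   with every pair containing [z]. Two colours with the same index pair would both be the guess for
   their common pair, so 50 colours would inject into 49 index pairs. *)
have good_in ctx (X : {set S}) : #|X| = 50 -> exists2 z, z \in X & good ctx z X.
  move=> cX50; apply/exists_inP/contraT => /exists_inPn nogood.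
  have /fin_all_exists[h Hh] z : exists i, z \in X -> i \in finset.setX Q Q /\
      forall B : {set S}, B \subset X -> #|B| <= 2 -> z \in B -> g w (psi ctx X B i) = z.
    have [zX|] := boolP (z \in X); last by exists (s, s).
    have := nogood z zX; rewrite /good cX50 zX /= => /forall_inPn[i iQ /existsPn Hi].
    exists i => _; split=> // B BX cB zB; have := Hi B.
    by rewrite BX cB zB /= => /negPn/eqP.
  have h_inj : {in X &, injective h}.
    move=> z z' zX z'X hz; apply/eqP/contraT => zz'.
    have [_ /(_ [set z; z'])] := Hh z zX; have [_ /(_ [set z; z'])] := Hh z' z'X.
    rewrite -hz subUset !sub1set zX z'X cards2 !inE !eqxx orbT zz' => /(_ isT isT isT)-> E.
    by rewrite E ?eqxx in zz'.
  have : #|h @: X| <= #|finset.setX Q Q|.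
    by apply: subset_leq_card; apply/subsetP => _ /imsetP[z zX ->]; have [] := Hh z zX.
  by rewrite card_in_imset // cX50 cardsX card_Q.
(* In each context at most 49 colours are good for no [X], since 50 of them would form an [X]
   containing a good one. With at most 350 contexts some colour remains. *)
have [||z _ Hz] := @exists_outside _ _ (finset.setX Xu Xv) [set: S]
    (fun ctx => [set z | [forall X : {set S}, ~~ good ctx z X]]) 49.
- move=> ctx _; rewrite leqNgt; apply/negP => /subset_of_card[X Xbad cX50].
  have [z zX gz] := good_in ctx X cX50.
  by have := subsetP Xbad z zX; rewrite inE => /forallP/(_ X); rewrite gz.
- by rewrite cardsX cardsT; apply: leq_ltn_trans card_S; rewrite leq_mul2r cX orbT.
pose XX ctx := odflt set0 [pick X | good ctx z X].
have XXgood a b : a \in Xu -> b \in Xv -> good (a, b) z (XX (a, b)).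
  move=> aX bX; have := Hz (a, b); rewrite in_setX aX bX inE => /(_ isT)/forallPn[X].
  rewrite negbK /XX; case: pickP => [//|/(_ X) -> //].
have XX50 a b : a \in Xu -> b \in Xv -> #|XX (a, b)| <= 50.
  by move=> aX bX; have /and3P[] := XXgood a b aX bX.
have zXX a b : a \in Xu -> b \in Xv -> z \in XX (a, b).
  by move=> aX bX; have /and3P[] := XXgood a b aX bX.
(* Index and view are chosen from the set [A] of colours of [u] and the colour of [v], not from the
   actual colour in [A], as [grid] demands. Arguments outside the hypotheses get a default. *)
have /fin_all_exists[fl Hfl] (p : {set S} * S) : exists il : S * (T -> S),
    p.1 \subset Xu -> #|p.1| <= 2 -> p.2 \in Xv -> il.1 \in Q /\
    forall a (B : {set S}), a \in p.1 -> B \subset XX (a, p.2) -> #|B| <= 2 -> z \in B ->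
    exists phi, [/\ phi u = a, phi w = z, unguessed W1 phi,
      seen_as u W1 phi il.2 & seen_as w W1 phi (view1 (XX (a, p.2)) B il.1)].
  case: p => A b /=; have [AX|] := boolP (A \subset Xu); last by exists (s, fun=> s).
  have [cA|] := leqP #|A| 2; last by exists (s, fun=> s).
  have [bX|] := boolP (b \in Xv); last by exists (s, fun=> s).
  have [||i [lam [iL H]]] := Hview1 z A (fun a => XX (a, b)) L cA _ _ LQ cL.
  - by move=> a aA; apply: XX50 => //; apply: (subsetP AX).
  - by move=> a aA; apply: zXX => //; apply: (subsetP AX).
  by exists (i, lam) => _ _ _; split=> //; apply: (subsetP LQ).
have /fin_all_exists[fr Hfr] (p : {set S} * S) : exists il : S * (T -> S),
    p.1 \subset Xv -> #|p.1| <= 2 -> p.2 \in Xu -> il.1 \in Q /\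
    forall b (B : {set S}), b \in p.1 -> B \subset XX (p.2, b) -> #|B| <= 2 -> z \in B ->
    exists phi, [/\ phi v = b, phi w = z, unguessed W2 phi,
      seen_as v W2 phi il.2 & seen_as w W2 phi (view2 (XX (p.2, b)) B il.1)].
  case: p => A a /=; have [AX|] := boolP (A \subset Xv); last by exists (s, fun=> s).
  have [cA|] := leqP #|A| 2; last by exists (s, fun=> s).
  have [aX|] := boolP (a \in Xu); last by exists (s, fun=> s).
  have [||i [lam [iL H]]] := Hview2 z A (fun b => XX (a, b)) L cA _ _ LQ cL.
  - by move=> b bA; apply: XX50 => //; apply: (subsetP AX).
  - by move=> b bA; apply: zXX => //; apply: (subsetP AX).
  by exists (i, lam) => _ _ _; split=> //; apply: (subsetP LQ).
exists (fun A b x => if x == w then z else (fl (A, b)).2 x),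
       (fun B a x => if x == w then z else (fr (B, a)).2 x).
move=> A B a b AX BX cA cB aA bB; have aX := subsetP AX a aA; have bX := subsetP BX b bB.
have [iQ Hl] := Hfl (A, b) AX cA bX; have [jQ Hr] := Hfr (B, a) BX cB aX.
set i := (fl (A, b)).1 in iQ Hl; set j := (fr (B, a)).1 in jQ Hr.
(* Only now, with both indices fixed, is the pair [C] picked for which [w] does not guess [z]; the
   fans permit this because their indices do not depend on it. *)
have /and3P[_ _ /forall_inP/(_ (i, j))] := XXgood a b aX bX.
rewrite in_setX iQ jQ => /(_ isT)/existsP[C /and4P[CX cC zC nguess]].
have [phi1 [p1u p1w p1W p1su p1sw]] := Hl a C aA CX cC zC.
have [phi2 [p2v p2w p2W p2sv p2sw]] := Hr b C bB CX cC zC.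
pose phi x := if x \in W1 then phi1 x else if x \in W2 then phi2 x else
  if x == w then z else if x == u then a else b.
have phiu : phi u = a by rewrite /phi (negbTE uW1) (negbTE uW2) (negbTE uw) eqxx.
have phiv : phi v = b.
  by rewrite /phi (negbTE vW1) (negbTE vW2) (negbTE vw) eq_sym (negbTE uv).
have phiw : phi w = z by rewrite /phi (negbTE wW1) (negbTE wW2) eqxx.
have phi1E : {in W1, phi1 =1 phi} by move=> x xW; rewrite /phi xW.
have phi2E : {in W2, phi2 =1 phi}.
  by move=> x xW; rewrite /phi xW (disjointFl d12 xW).
have notw x : x \in W1 :|: W2 -> (x == w) = false.
  by apply: contraTF => /eqP->; rewrite in_setU negb_or wW1.
exists phi; split=> //.
- move=> x; rewrite !in_setU in_set1 => /or3P[/eqP->|xW|xW].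
  + rewrite phiw; have <- : g w (psi (a, b) (XX (a, b)) C (i, j)) = g w phi; last exact: nguess.
    apply: g_local => y ewy; rewrite /psi.
    have [->|yu] := eqVneq y u; first by rewrite phiu.
    have [->|yv] := eqVneq y v; first by rewrite phiv.
    have := encl w y; rewrite !in_setU !in_set1 eqxx (negbTE yu) (negbTE yv) !orbF.
    move=> /(_ isT ewy); case: eqP => [yw|_ /=]; first by move: ewy; rewrite yw e_irr.
    move=> yW; case: ifP => yW1; first by rewrite -phi1E // p1sw.
    have yW2 : y \in W2 by move: yW; rewrite yW1.
    by rewrite -phi2E // p2sw.
  + by apply: (unguessed_enclosed encl1 phi1E _ _ p1W xW); rewrite ?phiu ?phiw.
  + by apply: (unguessed_enclosed encl2 phi2E _ _ p2W xW); rewrite ?phiv ?phiw.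
- move=> x; rewrite !in_setU in_set1 => /or3P[/eqP->|xW|xW] eux.
  + by rewrite eqxx.
  + by rewrite notw ?in_setU ?xW // -phi1E // p1su.
  + have := encl2 x u xW; rewrite e_sym (negbTE uw) (negbTE uv) (negbTE uW2) => /(_ eux).
    by [].
- move=> x; rewrite !in_setU in_set1 => /or3P[/eqP->|xW|xW] evx.
  + by rewrite eqxx.
  + have := encl1 x v xW; rewrite e_sym (negbTE vw) eq_sym (negbTE uv) (negbTE vW1) => /(_ evx).
    by [].
  + by rewrite notw ?in_setU ?xW ?orbT // -phi2E // p2sv.
Qed.

Lemma strip_grid u v W : strip e u v W -> [/\ grid u v W, fan u v W & fan v u W].
Proof.
elim=> {u v W} [u v uv|u v w W1 W2 uv uW vW wW d12 cW c1 c2 _ [g1 fl1 fr1] _ [g2 fl2 fr2]].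
  by split; [exact: grid0|exact: fan0|apply: fan0; rewrite eq_sym].
split; first exact: gridU.
  exact: fanU.
rewrite (setUC W1) in uW vW wW cW *; apply: fanU => //.
- by rewrite eq_sym.
- by rewrite disjoint_sym.
- exact: enclosed_sym.
- exact: enclosed_sym.
- exact: enclosed_sym.
- exact: grid_sym.
Qed.

Lemma strip_unguessed u v W : strip e u v W -> exists phi, unguessed W phi.
Proof.
move=> /strip_grid[guv _ _]; have [s _] := S_inhabited.
have [|lam [rho H]] := guv [set s] [set s]; first by rewrite cards1.
have [||||||phi []] := H [set s] [set s] s s; rewrite ?cards1 ?inE //.
by exists phi.
Qed.
End Colouring.

Lemma uncrossed_unguessed (V : finType) (e t : rel V) (S : finType)
    (g : V -> (V -> S) -> S) :
  symmetric e -> irreflexive e -> tournament t -> uncrossed e t setT ->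
  (forall x phi psi, (forall y, e x y -> phi y = psi y) -> g x phi = g x psi) ->
  350 * 49 < #|S| -> exists phi, forall x, g x phi != phi x.
Proof.
move=> e_sym e_irr tour unc gloc cS.
have [Q _ cQ] : exists2 Q : {set S}, Q \subset setT & #|Q| = 7.
  by apply: subset_of_card; rewrite cardsT; apply: leq_trans cS.
have [s _] := S_inhabited cQ.
(* The two extra isolated vertices serve as the ends of the strip. *)
pose T : finType := (V + bool)%type.
pose e' (x y : T) := if x is inl x then if y is inl y then e x y else false else false.
pose t' (x y : T) := match x, y with
  | inl x, inl y => t x y | inl _, inr b => b | inr b, inl _ => ~~ b
  | inr b, inr b' => ~~ b && b' end.
pose g' (x : T) (phi : T -> S) := if x is inl x then g x (phi \o inl) else s.
pose W : {set T} := [set x | if x is inl _ then true else false].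
have os : ordered_strip e' t' (inr false) (inr true) W.
  split=> //; last by case=> [x|b]; rewrite inE.
  - by case=> [x|[]] [y|[]] //= xy; rewrite (tour x y) //; apply: contraNneq xy => ->.
  - case=> [a|?] [b|?] [c|?] [d|?] //= _ _ _ _ eab ecd ac ad bc bd.
    by apply: unc; rewrite ?inE.
have st : strip e' (inr false) (inr true) W.
  apply: (ordered_strip_strip _ _ os); rewrite ?inE //.
  - by case=> [x|b] [y|b'] //=; rewrite e_sym.
  - by case=> [x|b] //=; rewrite e_irr.
  - by case=> [x|b] [y|b'] //=; rewrite !inE.
have e'_sym : symmetric e' by case=> [x|b] [y|b'] //=; rewrite e_sym.
have e'_irr : irreflexive e' by case=> [x|b] //=; rewrite e_irr.
have g'loc x phi psi : (forall y, e' x y -> phi y = psi y) -> g' x phi = g' x psi.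
  by case: x => [x|b] //= eq; apply: gloc => y exy; exact: (eq (inl y)).
have [phi Hphi] := strip_unguessed e'_sym e'_irr g'loc cQ cS st.
by exists (phi \o inl) => x; apply: (Hphi (inl x)); rewrite inE.
Qed.

(** * Crossing parity of polygonal chains *)

From mathcomp Require Import all_order all_algebra ring lra.
Import Order.TTheory GRing.Theory Num.Theory.
Local Open Scope ring_scope.

Lemma addb_telescope (a : nat -> bool) n :
  \big[addb/false]_(i < n) (a i (+) a i.+1) = a 0%N (+) a n.
Proof.
elim: n => [|n IHn]; first by rewrite big_ord0 addbb.
by rewrite big_ord_recr /= IHn; case: (a 0%N); case: (a n); case: (a n.+1).
Qed.

Section Crossing.
Variable R : realFieldType.
Implicit Types p q : R * R.

(** The right half of the axis is included so that exactly one of [p] and [- p] is upper when [p] is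
    not 0. *)
Definition upper p := (0 < p.2) || ((p.2 == 0) && (0 < p.1)).

(* Crossing of the right half of the horizontal axis.  Looking at the abscissa
   of [p] alone is enough because this is only used for [p] and [q] close to each
   other and away from 0. *)
Definition crosses p q := (upper p != upper q) && (0 < p.1).

Definition near_by (d : R) p q := (`|q.1 - p.1| < d) && (`|q.2 - p.2| < d).

Definition far (d : R) p q := (d <= `|q.1 - p.1|) || (d <= `|q.2 - p.2|).

Lemma upperN p : p != 0 -> upper (- p) = ~~ upper p.
Proof.
case: p => x y; rewrite /upper /= oppr_eq0 !oppr_gt0 => xy.
have [y0|y0|y0] := ltgtP y 0 => //=.
have [x0|x0|x0] := ltgtP x 0 => //=; by rewrite x0 y0 eqxx in xy.
Qed.

Lemma near_byC d p q : near_by d p q = near_by d q p.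
Proof. by rewrite /near_by (distrC q.1) (distrC q.2). Qed.

Lemma farC d p q : far d p q = far d q p.
Proof. by rewrite /far (distrC q.1) (distrC q.2). Qed.

Lemma upper_near d p q : d <= `|p.2| -> near_by d p q -> upper q = upper p.
Proof.
move=> dp /andP[_ npq]; rewrite /upper.
have [y0|y0|y0] := ltgtP p.2 0; rewrite /=.
- have qy : q.2 < 0.
    move: dp npq; rewrite ltr0_norm // => dp; rewrite ltr_norml => /andP[_]; lra.
  by case: ltgtP qy.
- have qy : 0 < q.2.
    move: dp npq; rewrite gtr0_norm // => dp; rewrite ltr_norml => /andP[+ _]; lra.
  by rewrite qy.
- by move: dp npq; rewrite y0 normr0 => dp /(le_lt_trans (normr_ge0 _)); lra.
Qed.

Lemma side_near d p q : d <= `|p.1| -> near_by d p q -> (0 < q.1) = (0 < p.1).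
Proof.
move=> dp /andP[npq _]; have [x0|x0|x0] := ltgtP p.1 0.
- apply/negbTE; rewrite -leNgt; apply: ltW.
  move: dp npq; rewrite ltr0_norm // => dp; rewrite ltr_norml => /andP[_]; lra.
- by move: dp npq; rewrite gtr0_norm // => dp; rewrite ltr_norml => /andP[+ _]; lra.
- by move: dp npq; rewrite x0 normr0 => dp /(le_lt_trans (normr_ge0 _)); lra.
Qed.

Lemma far0 d p : far d 0 p = (d <= `|p.1|) || (d <= `|p.2|).
Proof. by rewrite /far !subr0. Qed.

(** If some point has ordinate at least [d] in absolute value, all four agree on [upper] and nothing
    crosses. Otherwise all four are on one side of the vertical axis, and the changes of [upper]
    telescope around the cell. *)
Lemma crosses_cell d p q r s : far d 0 p -> far d 0 q -> far d 0 r -> far d 0 s ->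
  near_by d p q -> near_by d p r -> near_by d p s -> near_by d q r -> near_by d q s ->
  near_by d r s ->
  crosses p q (+) crosses s r = crosses p s (+) crosses q r.
Proof.
rewrite !far0 => fp fq fr fs pq pr ps qr qs rs.
have eqs : upper q = upper p -> upper r = upper p -> upper s = upper p ->
    crosses p q (+) crosses s r = crosses p s (+) crosses q r.
  by rewrite /crosses => -> -> ->; rewrite eqxx.
have [dp|] := boolP (d <= `|p.2|); first by apply: eqs; apply: upper_near dp _.
move: fp; case: (d <= `|p.2|) => //; rewrite orbF => fp _.
have [dq|] := boolP (d <= `|q.2|).
  have Eqp : upper p = upper q by apply: upper_near dq _; rewrite near_byC.
  by apply: eqs; rewrite ?Eqp //; apply: upper_near dq _.
move: fq; case: (d <= `|q.2|) => //; rewrite orbF => fq _.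
have [dr|] := boolP (d <= `|r.2|).
  have Erp : upper p = upper r by apply: upper_near dr _; rewrite near_byC.
  by apply: eqs; rewrite ?Erp //; apply: upper_near dr _; rewrite // near_byC.
move: fr; case: (d <= `|r.2|) => //; rewrite orbF => fr _.
have [ds|] := boolP (d <= `|s.2|).
  have Esp : upper p = upper s by apply: upper_near ds _; rewrite near_byC.
  by apply: eqs; rewrite ?Esp //; apply: upper_near ds _; rewrite // near_byC.
move: fs; case: (d <= `|s.2|) => //; rewrite orbF => fs _.
rewrite /crosses (side_near fp pq) (side_near fp ps).
by case: (upper p); case: (upper q); case: (upper r); case: (upper s); case: (0 < p.1).
Qed.

(** Negation turns crossings of the right half axis into crossings of the left half; both kinds
    together are the changes of [upper]. *)
Lemma crossesN d p q : 0 < d -> far d 0 p -> far d 0 q -> near_by d p q ->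
  crosses (- p) (- q) = crosses p q (+) (upper p (+) upper q).
Proof.
move=> d0 fp fq pq; have nz r : far d 0 r -> r != 0.
  by rewrite far0; apply: contraTneq => ->; rewrite /= normr0 leNgt d0.
rewrite /crosses !upperN ?nz //= oppr_gt0.
have [->|upq] := eqVneq (upper p) (upper q); first by rewrite eqxx addbb.
have -> : (~~ upper p != ~~ upper q) by move: upq; case: (upper p); case: (upper q).
have -> : upper p (+) upper q by move: upq; case: (upper p); case: (upper q).
move: fp; rewrite far0 => /orP[fp|fp]; last by rewrite (upper_near fp pq) eqxx in upq.
by rewrite addbT /=; case: ltgtP fp => // ->; rewrite normr0 leNgt d0.
Qed.

(** Parity of the crossings of a chain with the horizontal ray to the right of [v]; for a closed
    chain away from [v], the winding number modulo 2. *)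
Definition winding v (f : nat -> R * R) n :=
  \big[addb/false]_(j < n) crosses (f j - v) (f j.+1 - v).

(** A discrete homotopy: the differences [f j - e i] form a grid that stays away from 0, and the
    crossings around each cell cancel, hence also those around the border. Two sides of the border
    give the left-hand side; the other two, negated, give the right-hand side with its [upper]
    corrections. *)
Lemma winding_separated d (e f : nat -> R * R) n m : 0 < d ->
  (forall i j, (i <= n)%N -> (j <= m)%N -> far d (e i) (f j)) ->
  (forall i, (i < n)%N -> near_by (d / 2) (e i) (e i.+1)) ->
  (forall j, (j < m)%N -> near_by (d / 2) (f j) (f j.+1)) ->
  winding (e 0%N) f m (+) winding (e n) f m =
  winding (f 0%N) e n (+) winding (f m) e n (+)
  (upper (e 0%N - f 0%N) (+) upper (e n - f 0%N) (+)
   (upper (e 0%N - f m) (+) upper (e n - f m))).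
Proof.
move=> d0 efar enear fnear.
pose F i j := f j - e i.
have Ffar i j : (i <= n)%N -> (j <= m)%N -> far d 0 (F i j).
  by move=> /efar H /H; rewrite far0.
have half : d / 2 < d by lra.
have FE i j i' j' : (F i' j').1 - (F i j).1 = ((f j').1 - (f j).1) - ((e i').1 - (e i).1).
  by rewrite /F /=; ring.
have FE2 i j i' j' : (F i' j').2 - (F i j).2 = ((f j').2 - (f j).2) - ((e i').2 - (e i).2).
  by rewrite /F /=; ring.
have Fnear i j i' j' : (i' == i) || near_by (d / 2) (e i) (e i') ->
    (j' == j) || near_by (d / 2) (f j) (f j') -> near_by d (F i j) (F i' j').
  have aux (x y : R) : `|x| < d / 2 -> `|y| < d / 2 -> `|x - y| < d.
    by rewrite !ltr_norml => /andP[? ?] /andP[? ?]; apply/andP; split; lra.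
  have z : `|0 : R| < d / 2 by rewrite normr0; lra.
  move=> Hi Hj; rewrite /near_by FE FE2; apply/andP; split; apply: aux.
  - by case/orP: Hj => [/eqP->|/andP[]//]; rewrite subrr.
  - by case/orP: Hi => [/eqP->|/andP[]//]; rewrite subrr.
  - by case/orP: Hj => [/eqP->|/andP[]//]; rewrite subrr.
  - by case/orP: Hi => [/eqP->|/andP[]//]; rewrite subrr.
have row i : (i < n)%N -> winding (e i) f m (+) winding (e i.+1) f m =
    crosses (F i 0%N) (F i.+1 0%N) (+) crosses (F i m) (F i.+1 m).
  move=> ni; rewrite -(addb_telescope (fun j => crosses (F i j) (F i.+1 j))).
  rewrite -big_split /=; apply: eq_bigr => -[j jm] _ /=.
  have [ni' jm'] := (ltnW ni, ltnW jm).
  have [en fn] := (enear i ni, fnear j jm).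
  have en' : near_by (d / 2) (e i.+1) (e i) by rewrite near_byC.
  have fn' : near_by (d / 2) (f j.+1) (f j) by rewrite near_byC.
  apply: (@crosses_cell d _ _ (F i.+1 j.+1)); first [exact: Ffar
    | by apply: Fnear; rewrite ?eqxx ?en ?fn ?fn' ?orbT].
have col j : (j <= m)%N -> \big[addb/false]_(i < n) crosses (F i j) (F i.+1 j) =
    winding (f j) e n (+) (upper (e 0%N - f j) (+) upper (e n - f j)).
  move=> jm; rewrite -(addb_telescope (fun i => upper (e i - f j))) -big_split /=.
  apply: eq_bigr => -[i ni] _ /=; rewrite /F -(opprB (e i)) -(opprB (e i.+1)).
  apply: (crossesN d0).
  - by rewrite far0 /= (distrC (e i).1) (distrC (e i).2); apply: efar => //; apply: ltnW.
  - by rewrite far0 /= (distrC (e _).1) (distrC (e _).2); apply: efar.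
  - have /andP[a b] := enear i ni; apply/andP; split; rewrite /=.
      by rewrite opprB addrA subrK (lt_trans a).
    by rewrite opprB addrA subrK (lt_trans b).
rewrite -(addb_telescope (fun i => winding (e i) f m)).
rewrite (eq_bigr (fun i : 'I_n => crosses (F i 0%N) (F i.+1 0%N) (+) crosses (F i m) (F i.+1 m))); last first.
  by move=> i _; apply: row.
by rewrite big_split /= !col // addbACA.
Qed.
End Crossing.

(** * The order of spokes around a point *)

Section Chains.
Variable R : realFieldType.

Record chain (eps : R) (p q : R * R) := Chain {
  point :> nat -> R * R;
  last_index : nat;
  chain_first : point 0 = p;
  chain_last : point last_index = q;
  chain_near : forall i, (i < last_index)%N -> near_by eps (point i) (point i.+1) }.

Definition apart (d : R) (eps eps' : R) p q p' q' (f : chain eps p q) (f' : chain eps' p' q') :=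
  forall i j, (i <= last_index f)%N -> (j <= last_index f')%N -> far d (f i) (f' j).

Definition turns v (eps : R) p q (f : chain eps p q) := winding v f (last_index f).

Lemma turns_apart (d : R) a b c c' (f : chain (d / 2) a b) (h : chain (d / 2) c c') :
  0 < d -> apart d f h ->
  turns a h (+) turns b h = turns c f (+) turns c' f (+)
  (upper (a - c) (+) upper (b - c) (+) (upper (a - c') (+) upper (b - c'))).
Proof.
move=> d0 fh; have := winding_separated d0 fh (@chain_near _ _ _ f) (@chain_near _ _ _ h).
by rewrite !chain_first !chain_last.
Qed.

Lemma upperB (p q : R * R) : p != q -> upper (p - q) = ~~ upper (q - p).
Proof. by move=> pq; rewrite -upperN ?opprB // subr_eq0 eq_sym. Qed.

Lemma addb_xorb b c : b (+) c = xorb b c.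
Proof. by case: b; case: c. Qed.

Variables (V : finType) (e : rel V) (pos : V -> R * R) (p : R * R) (d : R).
Hypothesis pos_inj : injective pos.
Hypothesis d_gt0 : 0 < d.
Variable edge : forall a b, chain (d / 2) (pos a) (pos b).
Variable spoke : forall a, chain (d / 2) p (pos a).
Hypothesis edges_apart : forall a b c c', e a b -> e c c' ->
  a != c -> a != c' -> b != c -> b != c' -> apart d (edge a b) (edge c c').
Hypothesis edge_spoke_apart : forall a b c, e a b -> a != c -> b != c ->
  apart d (edge a b) (spoke c).

(* When the spokes leave [p] without crossing, this is their order around [p]. *)
Definition spoke_order x y :=
  turns (pos x) (spoke y) (+) turns (pos y) (spoke x) (+) upper (pos x - pos y).

Lemma spoke_order_tournament : tournament spoke_order.
Proof.
move=> x y xy; rewrite /spoke_order (@upperB (pos x)) ?(inj_eq pos_inj) //.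
by case: (turns (pos x) _); case: (turns (pos y) _); case: (upper _).
Qed.

Lemma apartC (eps eps' : R) q r q' r' (f : chain eps q r) (f' : chain eps' q' r') :
  apart d f f' -> apart d f' f.
Proof. by move=> H i j ? ?; rewrite farC; apply: H. Qed.

(** Five pairs of chains are apart: the two edges, and each edge with the two spokes to the ends of
    the other. In the sum of their relations all terms with [p] and all turns of edges occur twice;
    what survives is the required sum. *)
Lemma spoke_order_uncrossed (D : {set V}) : uncrossed e spoke_order D.
Proof.
move=> a b c c' _ _ _ _ eab ecc ac ac' bc bc'.
have E1 := turns_apart d_gt0 (edges_apart eab ecc ac ac' bc bc').
have E2 := turns_apart d_gt0 (edge_spoke_apart eab ac bc).
have E3 := turns_apart d_gt0 (edge_spoke_apart eab ac' bc').
have [ca cb c'a c'b] : [/\ c != a, c != b, c' != a & c' != b].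
  by rewrite !(eq_sym c) !(eq_sym c').
have E4 := turns_apart d_gt0 (apartC (edge_spoke_apart ecc ca c'a)).
have E5 := turns_apart d_gt0 (apartC (edge_spoke_apart ecc cb c'b)).
rewrite /spoke_order.
have sum0 x y z w v x' y' z' w' v' : x = x' -> y = y' -> z = z' -> w = w' -> v = v' ->
    x (+) x' (+) (y (+) y') (+) (z (+) z') (+) (w (+) w') (+) (v (+) v') = false.
  by do 5 move=> ->; rewrite !addbb.
rewrite -(sum0 _ _ _ _ _ _ _ _ _ _ E1 E2 E3 E4 E5) !addb_xorb.
btauto.
Qed.
End Chains.

(** * From a plane drawing to a tournament *)

From mathcomp Require Import all_classical all_reals all_analysis.
Import numFieldNormedType.Exports.
Local Open Scope classical_set_scope.

(** The class of [x] and its complement are both open relative to [A]. This serves twice, for chains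
    along an arc and for chains inside a face. *)
Lemma connected_locally (T : topologicalType) (A : set T) (r : T -> T -> Prop) :
  connected A ->
  (forall x y, r x y -> r y x) -> (forall x y z, r x y -> r y z -> r x z) ->
  (forall x, A x -> exists2 U, nbhs x U & forall y, A y -> U y -> r x y) ->
  forall x y, A x -> A y -> r x y.
Proof.
move=> cA rC rT loc x y Ax Ay.
have rxx z : A z -> r z z.
  by move=> Az; have [U Uz] := loc z Az; apply => //; apply: nbhs_singleton.
pose O (P : set T) := \bigcup_(U in [set U | open U /\ A `&` U `<=` P]) U.
have oO P : open (O P) by apply: bigcup_open => U [].
have AO P : (forall z, A z -> P z -> exists2 U, nbhs z U & A `&` U `<=` P) ->
    A `&` O P = A `&` P.
  move=> locP; apply/seteqP; split=> z [Az].
    by move=> [U [_ UP] Uz]; split => //; apply: UP.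
  move=> Pz; split=> //; have [U Uz UP] := locP z Az Pz.
  exists U^°; last exact: Uz.
  by split; [exact: open_interior|move=> t [At /interior_subset Ut]; apply: UP].
suff : A `&` r x = A by move=> E; move: Ay; rewrite -E => -[].
apply: cA; first by exists x; split=> //; apply: rxx.
- exists (O (r x)) => //; rewrite AO // => z Az rxz.
  have [U Uz Ur] := loc z Az; exists U => // t [At Ut]; apply: (rT _ z) => //.
  exact: Ur.
- exists (~` O (~` r x)); first exact/open_closedC.
  have E : A `&` O (~` r x) = A `&` ~` r x.
    apply: AO => z Az nrxz; have [U Uz Ur] := loc z Az; exists U => // t [At Ut] rxt.
    by apply: nrxz; apply: (rT _ t) => //; apply/rC/Ur.
  apply/seteqP; split=> z [Az Hz]; split=> //.
    by move=> Oz; have [_] : (A `&` ~` r x) z by [rewrite -E; split]; exact.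
  by apply: contrapT => nrz; apply: Hz; suff [] : (A `&` O (~` r x)) z by []; rewrite E.
Qed.

Lemma common_bound (R : realType) (I : finType) (P : I -> R -> Prop) :
  (forall i d d', 0 < d' -> d' <= d -> P i d -> P i d') ->
  (forall i, exists2 d, 0 < d & P i d) -> exists2 d, 0 < d & forall i, P i d.
Proof.
move=> mono /fin_all_exists2[f f0 fP].
exists (\big[Num.min/1]_i f i) => [|i]; first by apply/lt_bigmin.
apply: mono (fP i); first by apply/lt_bigmin.
exact: bigmin_le_cond.
Qed.

(** * Compact separation and fine chains in the plane *)

Section Plane.
Variable R : realType.
Implicit Types (p q : R * R) (A B : set (R * R)).

Lemma far_norm d p q : far d p q = (d <= `|p - q|).
Proof. by rewrite prod_normE le_max /= !(distrC p.1) !(distrC p.2). Qed.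

Lemma near_by_ball d p q : near_by d p q <-> ball p d q.
Proof.
split; first by move=> /andP[a b]; split; rewrite /ball /= distrC.
by move=> [a b]; apply/andP; split; rewrite distrC.
Qed.

Lemma disjoint_compact_far A B : compact A -> compact B -> A `&` B = set0 ->
  exists2 d, 0 < d & forall p q, A p -> B q -> far d p q.
Proof.
move=> cA cB AB0.
have [[[p0 q0] [/= Ap0 Bq0]]|] := pselect ((A `*` B) !=set0); last first.
  move=> AB; exists 1 => // p q Ap Bq; case: AB; by exists (p, q).
have cf : {within A `*` B, continuous (fun z : (R * R) * (R * R) => `|z.1 - z.2|)}.
  apply: continuous_subspaceT => z; apply: cvg_norm; apply: cvgB; [exact: cvg_fst|exact: cvg_snd].
have [|[p1 q1]] := compact_EVT_min _ (compact_setX cA cB) cf.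
  by exists (p0, q0).
rewrite inE => -[/= Ap1 Bq1] min.
exists `|p1 - q1|.
  rewrite normr_gt0 subr_eq0; apply/eqP => E.
  by have : (A `&` B) p1; [split=> //; rewrite E|rewrite AB0].
by move=> p q Ap Bq; rewrite far_norm; apply: (min (p, q)); rewrite inE.
Qed.

Definition linked eps (S : set (R * R)) p q :=
  exists f : chain eps p q, forall i, (i <= last_index f)%N -> S (f i).

Lemma linkedW eps (S S' : set (R * R)) p q : S `<=` S' -> linked eps S p q -> linked eps S' p q.
Proof. by move=> SS' [f Hf]; exists f => i /Hf/SS'. Qed.

Lemma linked_sym eps (S : set (R * R)) p q : linked eps S p q -> linked eps S q p.
Proof.
move=> [f Sf]; pose n := last_index f.
have ge0 : f (n - 0)%N = q by rewrite subn0 chain_last.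
have gen : f (n - n)%N = p by rewrite subnn chain_first.
have gnear i : (i < n)%N -> near_by eps (f (n - i)%N) (f (n - i.+1)%N).
  by move=> ni; rewrite near_byC -(subnSK ni); apply: chain_near; rewrite subnSK // leq_subr.
exists (@Chain _ eps q p (fun i => f (n - i)%N) n ge0 gen gnear) => i _ /=.
by apply: Sf; apply: leq_subr.
Qed.

Lemma linked_trans eps (S : set (R * R)) p q r :
  linked eps S p q -> linked eps S q r -> linked eps S p r.
Proof.
move=> [f Sf] [g Sg]; pose n := last_index f; pose m := last_index g.
pose h i := if (i <= n)%N then f i else g (i - n)%N.
have hg i : h (n + i)%N = g i.
  rewrite /h; case: i => [|i]; first by rewrite addn0 leqnn chain_last chain_first.
  by rewrite -{2}(addn0 n) leq_add2l /= addKn.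
have h0 : h 0%N = p by rewrite /h chain_first.
have hnm : h (n + m)%N = r by rewrite hg chain_last.
have hnear i : (i < n + m)%N -> near_by eps (h i) (h i.+1).
  move=> inm; have [ni|ni] := ltnP i n; first by rewrite /h ni (ltnW ni); apply: chain_near.
  have : (i - n < m)%N by rewrite ltn_subLR.
  by rewrite -{2 3}(subnKC ni) -addnS !hg; exact: chain_near.
exists (@Chain _ eps p r h (n + m) h0 hnm hnear) => i /= inm.
have [ni|/ltnW ni] := leqP i n; first by rewrite /h ni; apply: Sf.
by move: inm; rewrite -(subnKC ni) hg leq_add2l; apply: Sg.
Qed.

Lemma linked_near eps (S : set (R * R)) p q :
  near_by eps p q -> S p -> S q -> linked eps S p q.
Proof.
move=> pq Sp Sq; pose h i := if i is 0%N then p else q.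
have hnear i : (i < 1)%N -> near_by eps (h i) (h i.+1) by case: i.
by exists (@Chain _ eps p q h 1 erefl erefl hnear) => -[|i].
Qed.

Lemma linked_segment eps d p q : 0 < eps -> near_by d p q ->
  linked eps [set x | near_by d p x] p q.
Proof.
move=> eps0 /andP[pq1 pq2]; pose n := (Num.truncn (d / eps)).+1.
have nd : d < eps * n%:R by rewrite mulrC -ltr_pdivrMr // truncnS_gt.
have n0 : 0 < n%:R :> R by rewrite ltr0n.
pose h1 a b i : R := a + i%:R / n%:R * (b - a).
have h10 a b : h1 a b 0%N = a by rewrite /h1 mul0r mul0r addr0.
have h1n a b : h1 a b n = b by rewrite /h1 divff ?gt_eqF // mul1r addrC subrK.
have h1near a b i : `|b - a| < d -> `|h1 a b i.+1 - h1 a b i| < eps.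
  move=> ab; have -> : h1 a b i.+1 - h1 a b i = (b - a) / n%:R.
    by rewrite /h1 -natr1; field; rewrite gt_eqF.
  by rewrite normrM normfV (gtr0_norm n0) ltr_pdivrMr // (lt_trans ab).
have h1in a b i : (i <= n)%N -> `|b - a| < d -> `|h1 a b i - a| < d.
  move=> ni; apply: le_lt_trans; rewrite /h1 addrC addKr normrM ler_piMl //.
  by rewrite ger0_norm ?divr_ge0 // ler_pdivrMr // mul1r ler_nat.
pose h i := (h1 p.1 q.1 i, h1 p.2 q.2 i).
have h0 : h 0%N = p by rewrite /h !h10; case: (p).
have hn : h n = q by rewrite /h !h1n; case: (q).
have hnear i : (i < n)%N -> near_by eps (h i) (h i.+1).
  by move=> _; apply/andP; split; apply: h1near.
exists (@Chain _ eps p q h n h0 hn hnear) => i /= ni.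
by apply/andP; split; apply: h1in.
Qed.

Lemma arc_linked A p q eps : 0 < eps -> is_arc A p q -> linked eps A p q.
Proof.
move=> eps0 [g [cg _ g0 g1 AE]]; rewrite AE.
have A0 : (g @` `[0, 1]) p by exists 0 => //; rewrite /= in_itv /= lexx ler01.
have A1 : (g @` `[0, 1]) q by exists 1 => //; rewrite /= in_itv /= lexx ler01.
apply: (connected_locally (r := linked eps (g @` `[0, 1]))) A0 A1.
- apply: connected_continuous_connected cg; exact: segment_connected.
- by move=> x y; apply: linked_sym.
- by move=> x y z; apply: linked_trans.
- move=> x Ax; exists (ball x eps); first exact: nbhsx_ballx.
  by move=> y Ay /near_by_ball xy; apply: linked_near.
Qed.

Lemma arc_compact A p q : is_arc A p q -> compact A.
Proof.
move=> [g [cg _ _ _ ->]].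
  by apply: (continuous_compact cg); exact: segment_compact.
Qed.
End Plane.

Lemma farW (R : realType) (d d' : R) (p q : R * R) : d' <= d -> far d p q -> far d' p q.
Proof. by move=> dd /orP[] /(le_trans dd) H; apply/orP; [left|right]. Qed.

Lemma far_near (R : realType) (d d' : R) (p q r : R * R) :
  far (d + d') p r -> near_by d' p q -> far d q r.
Proof.
move=> + /andP[a b] => /orP[] H; apply/orP; [left|right].
  have := ler_distD q.1 r.1 p.1; move: a H; lra.
have := ler_distD q.2 r.2 p.2; move: b H; lra.
Qed.

(** * Spokes inside a face *)

Section DrawingOrder.
Variables (R : realType) (G : sgraph) (D : plane_drawing R G).

Lemma point_edges_far (P : rel G) (x : R * R) :
  (forall u v, P u v -> adj u v /\ ~ Defs.arc D u v x) ->
  exists2 d, 0 < d & forall u v, P u v -> forall y, Defs.arc D u v y -> far d x y.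
Proof.
move=> HP.
have [|[u v]|d d0 Hd] := @common_bound R (G * G)%type
  (fun uv d => P uv.1 uv.2 -> forall y, Defs.arc D uv.1 uv.2 y -> far d x y).
- by move=> [u v] d d' _ dd H Puv y uvy; apply: farW dd _; apply: H.
- have [Puv|] := boolP (P u v); last by exists 1.
  have [auv nx] := HP u v Puv.
  have [|||d d0 Hd] := @disjoint_compact_far R [set x] (Defs.arc D u v).
  + exact: compact_set1.
  + exact: arc_compact (arcP D auv).
  + by apply/seteqP; split=> // y [->].
  by exists d => // _ y; apply: Hd.
by exists d => // u v; apply: (Hd (u, v)).
Qed.

(** The distance [d] comes before the fineness [eps], because chains will later be taken with steps
    shorter than half the distance. Locally, a ball of half the distance to the arcs contains the
    subdivided segments from its centre. *)
Lemma face_linked F x y : is_face D F -> F x -> F y ->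
  exists2 d, 0 < d & forall eps, 0 < eps -> linked eps
    [set z | forall u v, adj u v -> forall t, Defs.arc D u v t -> far d z t] x y.
Proof.
move=> [q _ FE] Fx Fy.
pose free d := [set z | forall u v : G, adj u v -> forall t, Defs.arc D u v t -> far d z t].
have freeW d d' : d' <= d -> free d `<=` free d'.
  by move=> dd z Hz u v auv t uvt; apply: farW dd _; apply: (Hz u v).
pose r x y := exists2 d, 0 < d & forall eps, 0 < eps -> linked eps (free d) x y.
apply: (@connected_locally _ F r) Fx Fy.
- by rewrite FE; apply: component_connected.
- by move=> a b [d d0 H]; exists d => // eps /H; apply: linked_sym.
- move=> a b c [d d0 H] [d' d0' H']; exists (Num.min d d'); first by rewrite lt_min d0.
  move=> eps eps0; apply: (@linked_trans _ _ _ _ b).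
    by apply: linkedW (H eps eps0); apply: freeW; rewrite ge_min lexx.
  by apply: linkedW (H' eps eps0); apply: freeW; rewrite ge_min lexx orbT.
- move=> z Fz; have nz u v : adj u v -> adj u v /\ ~ Defs.arc D u v z.
    move=> auv; split=> // uvz; have : (~` drawn_set D) z.
      by move: Fz; rewrite FE; apply: connected_component_sub.
    by apply; right; exists u, v.
  have [d d0 Hd] := point_edges_far nz.
  exists (ball z (d / 2)); first by apply: nbhsx_ballx; apply: divr_gt0.
  move=> t Ft /near_by_ball zt; exists (d / 2); first by apply: divr_gt0.
  move=> eps eps0; apply: linkedW (linked_segment eps0 zt) => s zs u v auv w uvw.
  by apply: far_near zs; rewrite -splitr; apply: Hd uvw.
Qed.

(** The closure of [F] contains [pos D v], so [F] has a point so close to it that the last segment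
    of the chain stays away from every arc not ending at [v]. *)
Lemma vertex_linked F x v : is_face D F -> F x -> frontier F (pos D v) ->
  exists2 d, 0 < d & forall eps, 0 < eps -> linked eps
    [set z | forall a b, adj a b -> a != v -> b != v ->
       forall t, Defs.arc D a b t -> far d z t] x (pos D v).
Proof.
move=> faceF Fx [clF _].
have nv a b : [&& adj a b, a != v & b != v] -> adj a b /\ ~ Defs.arc D a b (pos D v).
  move=> /and3P[ab av bv]; split=> // /(arc_vertex ab)[vE|vE].
    by rewrite vE eqxx in av.
  by rewrite vE eqxx in bv.
have [d d0 Hd] := point_edges_far nv.
have d20 : 0 < d / 2 by apply: divr_gt0.
have [q [Fq /near_by_ball vq]] := clF _ (nbhsx_ballx (pos D v) (d / 2) d20).
have [d' d'0 Hd'] := face_linked faceF Fx Fq.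
exists (Num.min (d / 2) d'); first by rewrite lt_min d20.
move=> eps eps0; apply: (@linked_trans _ _ _ _ q).
  apply: linkedW (Hd' eps eps0) => z Hz a b ab _ _ t abt.
  by apply: farW (Hz a b ab t abt); rewrite ge_min lexx orbT.
apply: linked_sym; apply: linkedW (linked_segment eps0 vq) => z vz a b ab av bv t abt.
apply: (@farW _ (d / 2)); first by rewrite ge_min lexx.
by apply: far_near vz; rewrite -splitr; apply: (Hd a b) => //; rewrite ab av.
Qed.
End DrawingOrder.

Lemma outerplanar_uncrossed (R : realType) (G : sgraph) : outerplanar R G ->
  exists t : rel G, tournament t /\ uncrossed (@adj G) t [set: G]%SET.
Proof.
move=> [D [F [[faceF _] frF]]].
have [x Fx] : F !=set0.
  by have [p np FE] := faceF; exists p; rewrite FE; apply: connected_component_refl.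
have [||d1 d10 Hd1] := @common_bound R G (fun v d => forall eps, 0 < eps -> linked eps
    [set z | forall a b, adj a b -> a != v -> b != v ->
       forall t, Defs.arc D a b t -> far d z t] x (pos D v)).
- move=> v d d' _ dd H eps eps0; apply: linkedW (H eps eps0) => z Hz a b ab av bv t abt.
  by apply: farW dd _; apply: (Hz a b).
- by move=> v; apply: vertex_linked faceF Fx (frF v).
pose indep (q : G * G * (G * G)) := [&& adj q.1.1 q.1.2, adj q.2.1 q.2.2,
  q.1.1 != q.2.1, q.1.1 != q.2.2, q.1.2 != q.2.1 & q.1.2 != q.2.2].
have [||d2 d20 Hd2] := @common_bound R (G * G * (G * G))%type (fun q d => indep q ->
    forall s t, Defs.arc D q.1.1 q.1.2 s -> Defs.arc D q.2.1 q.2.2 t -> far d s t).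
- by move=> q d d' _ dd H iq s t Hs Ht; apply: farW dd _; apply: H.
- move=> [[a b] [c c']]; have [/and5P[/= ab cc ac ac' /andP[bc bc']]|] := boolP (indep _);
    last by exists 1.
  have [|||d d0 Hd] := @disjoint_compact_far R (Defs.arc D a b) (Defs.arc D c c').
  + exact: arc_compact (arcP D ab).
  + exact: arc_compact (arcP D cc).
  (* A common point would be a vertex, hence an end of both edges. *)
  + apply/seteqP; split=> // s [abs ccs].
    have ne : [set a; b]%SET <> [set c; c']%SET.
      by move/setP/(_ a); rewrite !inE eqxx (negbTE ac) (negbTE ac').
    have [v _ vs] := arc_cross ab cc ne (conj abs ccs).
    move: abs ccs; rewrite -vs => /(arc_vertex ab) abv /(arc_vertex cc) ccv.
    by case: abv ccv ac ac' bc bc' => -> [] ->; rewrite eqxx.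
  by exists d => // _ s t; apply: Hd.
pose d := Num.min d1 d2; have d0 : 0 < d by rewrite lt_min d10.
have eps0 : 0 < d / 2 by apply: divr_gt0.
(* Nonadjacent pairs need a chain too; a subdivided segment is a dummy there, with a bound exceeding
   both coordinate differences. *)
have Hedge a b : exists f : chain (d / 2) (pos D a) (pos D b),
    adj a b -> forall i, (i <= last_index f)%N -> Defs.arc D a b (f i).
  have [ab|nab] := boolP (adj a b).
    by have [f Hf] := arc_linked eps0 (arcP D ab); exists f.
  have [|f _] := @linked_segment R (d / 2) (`|(pos D b).1 - (pos D a).1| +
    `|(pos D b).2 - (pos D a).2| + 1) (pos D a) (pos D b) eps0; last by exists f.
  have := normr_ge0 ((pos D b).1 - (pos D a).1).
  have := normr_ge0 ((pos D b).2 - (pos D a).2).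
  by move=> ? ?; apply/andP; split; lra.
pose edge a b := projT1 (cid (Hedge a b)).
have edge_arc a b : adj a b -> forall i, (i <= last_index (edge a b))%N -> Defs.arc D a b (edge a b i).
  exact: (projT2 (cid (Hedge a b))).
pose spoke v := projT1 (cid (Hd1 v (d / 2) eps0)).
have spoke_far v := projT2 (cid (Hd1 v (d / 2) eps0)).
exists (spoke_order spoke); split; first by apply: spoke_order_tournament; exact: pos_inj.
apply: (spoke_order_uncrossed d0 (edge := edge)).
- move=> a b c c' ab cc ac ac' bc bc' i j ni nj; apply: (@farW _ d2); first by rewrite ge_min lexx orbT.
  apply: (Hd2 (a, b, (c, c'))); first by rewrite /indep /= ab cc ac ac' bc bc'.
    exact: edge_arc.
  exact: edge_arc.
- move=> a b c ab ac bc i j ni nj; apply: (@farW _ d1); first by rewrite ge_min lexx.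
  by rewrite farC; apply: (spoke_far c j nj a b ab ac bc); apply: edge_arc.
Qed.

(** * The bound on the number of colours *)

Lemma winnable_outerplanar (R : realType) (G : sgraph) (k : nat) :
  outerplanar R G -> winnable G k -> (k <= 350 * 49)%N.
Proof.
move=> /outerplanar_uncrossed[t [tour unc]] [Gamma win].
rewrite leqNgt; apply/negP => kbig.
pose g (v : G) (phi : G -> 'I_k) := Gamma v [ffun u : nbhd v => phi (val u)].
have g_local v phi psi : (forall y, adj v y -> phi y = psi y) -> g v phi = g v psi.
  move=> eq; rewrite /g; congr (Gamma v _); apply/ffunP => u; rewrite !ffunE.
  exact: eq (valP u).
have [|phi Hphi] := uncrossed_unguessed (@adj_sym G) (@adj_irrefl G) tour unc g_local.
  by rewrite card_ord.
have [v Hv] := win [ffun x => phi x]; case/eqP: (Hphi v).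
move: Hv; rewrite ffunE => <-; congr (Gamma v _); apply/ffunP => u.
by rewrite !ffunE.
Qed.

Theorem theorem1p2 (R : realType) (G : sgraph) :
  outerplanar R G -> (hat_guessing_number G < 2 ^ 125000)%N.
Proof.
(* 350 * 49 = 17150 is below 2 ^ 15 = 32768, a power small enough to compute with; the default value
   0 of [hat_guessing_number] is below it as well. *)
move=> out; apply: (@leq_trans (2 ^ 15)); last by rewrite leq_exp2l.
rewrite /hat_guessing_number; case: xgetP => [h _ [win _]|_]; last by rewrite expn_gt0.
by apply: leq_ltn_trans (winnable_outerplanar out win) _.
Qed.
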